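(* Let $C$ be an algebraically closed field of characteristic zero, let $R$ be a complete local noetherian $C$-algebra with maximal ideal $\mathfrak r$ and residue field $C$, and let $\tau\subset C$ be a subset such that the natural map $\tau\to C/\mathbb Z$ is bijective. Any $M\in\mathbf{MC}_{\rm rs}(R((x))/R)$ possesses a logarithmic model $\mathcal M$ such that, for every $k\in\mathbb N$, the object $\mathcal M|_k\in\mathbf{MC}_{\log}(C[[x]]/C)_{(R_k)}$ enjoys the following properties: (1) All its exponents lie in $\tau$. (2) It is free in relation to $R_k$. (3) The isomorphism $\gamma(\mathcal M|_k)\simeq M|_k$ is compatible with the action of $R_k$.
   Context: $R((x))=R[[x]][x^{-1}]$, $\vartheta(\sum a_nx^n)=\sum na_nx^n$, $R_k=R/\mathfrak r^{k+1}$. $\mathbf{MC}(R((x))/R)$: pairs $(M,\nabla)$ with $M$ a finitely generated $R((x))$-module and $\nabla:M\to M$ an $R$-linear map with $\nabla(fm)=\vartheta(f)m+f\nabla(m)$; arrows are linear maps commuting with $\nabla$. $\mathbf{MC}_{\log}(R[[x]]/R)$: the same with finitely generated $R[[x]]$-modules. $\gamma$ is the functor $\mathbf{MC}_{\log}(R[[x]]/R)\to\mathbf{MC}(R((x))/R)$ inverting $x$. $\mathbf{MC}_{\rm rs}(R((x))/R)$ is the full subcategory of $\mathbf{MC}(R((x))/R)$ of objects isomorphic to some $\gamma(\mathcal M)$; any $\mathcal M$ with an isomorphism $\gamma(\mathcal M)\simeq M$ is a logarithmic model of $M$. The same definitions with $R=C$ give the categories over $C$. For a $C$-linear category $\mathcal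 C$ and a commutative finite-dimensional $C$-algebra $\Lambda$, $\mathcal C_{(\Lambda)}$ is the category of pairs $(c,\alpha)$ with $c\in\mathcal C$ and $\alpha:\Lambda\to\mathrm{End}(c)$ a morphism of rings ($C$-algebras), with arrows those commuting with the actions. For $\mathcal M\in\mathbf{MC}_{\log}(R[[x]]/R)$, $\mathcal M|_k=\mathcal M/\mathfrak r^{k+1}\mathcal M$ with induced derivation and $R_k$-action, an object of $\mathbf{MC}_{\log}(C[[x]]/C)_{(R_k)}$; similarly $M|_k=M/\mathfrak r^{k+1}M\in\mathbf{MC}(C((x))/C)_{(R_k)}$. A $C[[x]]$-module $N$ with an action of $\Lambda$ is free in relation to $\Lambda$ if there is a $\Lambda$-module $V$ and an isomorphism of $C[[x]]$-modules $\psi:C[[x]]\otimes_CV\to N$ with $\psi(f\otimes\lambda v)=\lambda\,\psi(f\otimes v)$ for all $\lambda\in\Lambda$, $f$, $v$. For $(\mathcal N,\nabla)\in\mathbf{MC}_{\log}(C[[x]]/C)$ the residue is the $C$-linear endomorphism of $\mathcal N/x\mathcal N$ induced by $\nabla$, and the exponents are its eigenvalues. *)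

(* Defs.v *)
From HB Require Import structures.
From mathcomp Require Import all_boot all_order all_algebra ring_quotient.
From mathcomp Require Import boolp classical_sets.
From mathcomp Require Import freeg zify.

Set Implicit Arguments.
Unset Strict Implicit.
Unset Printing Implicit Defensive.

Import GRing.Theory Num.Theory Order.TTheory.
Local Open Scope ring_scope.
Local Open Scope classical_set_scope.
Local Open Scope quotient_scope.

Section Span.
Variables (A : comNzRingType) (M : lmodType A).
Implicit Types (S : set M) (I : set A).

Definition mspan S : set M := [set v | exists n (a : 'I_n -> A) (m : 'I_n -> M),
  (forall i, S (m i)) /\ v = \sum_i a i *: m i].

Definition fin_gen : Prop := exists n (e : 'I_n -> M), mspan (range e) = setT.

(* I S, the submodule generated by the products *)
Definition idmul I S : set M :=
  mspan [set v | exists a m, [/\ I a, S m & v = a *: m]].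

Lemma mspan0 S : mspan S 0.
Proof.
by exists 0, (fun=> 0), (fun=> 0); split=> [[]//|]; rewrite big_ord0.
Qed.

Lemma mspanD S u v : mspan S u -> mspan S v -> mspan S (u + v).
Proof.
move=> [n [a [x [Sx ->]]]] [p [b [y [Sy ->]]]].
exists (n + p)%N, (fun i => match fintype.split i with inl j => a j | inr j => b j end),
  (fun i => match fintype.split i with inl j => x j | inr j => y j end); split.
  by move=> i; case: (fintype.split i).
rewrite big_split_ord; congr (_ + _); apply: eq_bigr => i _ /=.
  by rewrite (unsplitK (inl i)).
by rewrite (unsplitK (inr i)).
Qed.

Lemma mspanZ S c v : mspan S v -> mspan S (c *: v).
Proof.
move=> [n [a [x [Sx ->]]]]; exists n, (fun i => c * a i), x; split=> //.
by rewrite scaler_sumr; apply: eq_bigr => i _; rewrite scalerA.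
Qed.

Lemma mspanN S v : mspan S v -> mspan S (- v).
Proof. by rewrite -scaleN1r; apply: mspanZ. Qed.

Lemma sub_mspan S v : S v -> mspan S v.
Proof.
move=> Sv; exists 1%N, (fun=> 1), (fun=> v); split=> //.
by rewrite big_ord1 scale1r.
Qed.

Lemma mspan_sum S n (x : 'I_n -> M) :
  (forall i, mspan S (x i)) -> mspan S (\sum_i x i).
Proof.
by move=> Sx; elim/big_ind: _ => //; [apply: mspan0 | apply: mspanD].
Qed.

Lemma mspan_min S (T : set M) : T 0 -> (forall u v, T u -> T v -> T (u + v)) ->
  (forall c v, T v -> T (c *: v)) -> S `<=` T -> mspan S `<=` T.
Proof.
move=> T0 TD TZ ST v [n [a [x [Sx ->]]]].
by elim/big_ind: _ => // i _; apply/TZ/ST.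
Qed.

Lemma mspan_rangeP n (e : 'I_n -> M) v :
  mspan (range e) v <-> exists a : 'I_n -> A, v = \sum_i a i *: e i.
Proof.
split=> [|[a ->]]; last first.
  by apply: mspan_sum => i; apply/mspanZ/sub_mspan; exists i.
move: v; apply: mspan_min.
- by exists (fun=> 0); rewrite big1 // => i _; rewrite scale0r.
- move=> u v [a ->] [b ->]; exists (fun i => a i + b i).
  by rewrite -big_split; apply: eq_bigr => i _; rewrite /= scalerDl.
- move=> c v [a ->]; exists (fun i => c * a i).
  by rewrite scaler_sumr; apply: eq_bigr => i _; rewrite scalerA.
- move=> _ [i _ <-]; exists (fun j => (j == i)%:R).
  rewrite (bigD1 i) //= eqxx scale1r big1 ?addr0 // => j /negbTE ->.
  by rewrite scale0r.
Qed.

Definition mspanp S : {pred M} := fun v => `[< mspan S v >].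

Lemma mspanpP S v : reflect (mspan S v) (v \in mspanp S).
Proof. exact: asboolP. Qed.

Lemma mspanp_zmod_closed S : zmod_closed (mspanp S).
Proof.
split=> [|u v /mspanpP Su /mspanpP Sv]; apply/mspanpP; first exact: mspan0.
by apply: mspanD => //; apply: mspanN.
Qed.
HB.instance Definition _ S :=
  GRing.isZmodClosed.Build M (mspanp S) (mspanp_zmod_closed S).

End Span.
Arguments fin_gen {A} M.

(* M / <S>; the operations are locked for the sake of unification *)
Definition qmod (A : comNzRingType) (M : lmodType A) (S : set M) : Type :=
  @Quotient.quot M (mspanp S).
HB.instance Definition _ (A : comNzRingType) (M : lmodType A) (S : set M) :=
  Choice.on (qmod S).

HB.lock Definition qpi (A : comNzRingType) (M : lmodType A) (S : set M) (v : M)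
  : qmod S := \pi_(@Quotient.quot M (mspanp S)) v.
HB.lock Definition qrepr (A : comNzRingType) (M : lmodType A) (S : set M)
  (v : qmod S) : M := repr (v : @Quotient.quot M (mspanp S)).

HB.lock Definition qzero (A : comNzRingType) (M : lmodType A) (S : set M) : qmod S :=
  qpi S 0.
HB.lock Definition qadd (A : comNzRingType) (M : lmodType A) (S : set M)
  (u v : qmod S) : qmod S := qpi S (qrepr u + qrepr v).
HB.lock Definition qopp (A : comNzRingType) (M : lmodType A) (S : set M)
  (v : qmod S) : qmod S := qpi S (- qrepr v).
HB.lock Definition qscale (A : comNzRingType) (M : lmodType A) (S : set M)
  (a : A) (v : qmod S) : qmod S := qpi S (a *: qrepr v).

Section Qmod.
Variables (A : comNzRingType) (M : lmodType A) (S : set M).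
Local Notation qpi := (qpi S).

Lemma qpi_eq u v : qpi u = qpi v <-> mspan S (u - v).
Proof.
have E : (u - v \in mspanp S) = (qpi u == qpi v).
  by rewrite qpi.unlock; exact: (Quotient.idealrBE (mspanp S)).
by split=> [/eqP|/mspanpP]; [rewrite -E => /mspanpP | rewrite E => /eqP].
Qed.

Lemma qpiK (v : qmod S) : qpi (qrepr v) = v.
Proof. by rewrite qpi.unlock qrepr.unlock; apply: reprK. Qed.

Lemma qpiP (v : qmod S) : exists m, v = qpi m.
Proof. by exists (qrepr v); rewrite qpiK. Qed.

Let qrepr_pi m : mspan S (qrepr (qpi m) - m).
Proof. by apply/qpi_eq; rewrite qpiK. Qed.

Let qaddE u v : qadd (qpi u) (qpi v) = qpi (u + v).
Proof.
by rewrite qadd.unlock; apply/qpi_eq; rewrite opprD addrACA; apply: mspanD.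
Qed.

Let qoppE v : qopp (qpi v) = qpi (- v).
Proof. by rewrite qopp.unlock; apply/qpi_eq; rewrite -opprD; apply: mspanN. Qed.

Let qscaleE a v : qscale a (qpi v) = qpi (a *: v).
Proof. by rewrite qscale.unlock; apply/qpi_eq; rewrite -scalerBr; apply: mspanZ. Qed.

Let qzeroE : qzero S = qpi 0. Proof. by rewrite qzero.unlock. Qed.

Lemma qaddA : associative (@qadd A M S).
Proof.
move=> u v w; have [x ->] := qpiP u; have [y ->] := qpiP v.
by have [z ->] := qpiP w; rewrite !qaddE addrA.
Qed.
Lemma qaddC : commutative (@qadd A M S).
Proof.
by move=> u v; have [x ->] := qpiP u; have [y ->] := qpiP v; rewrite !qaddE addrC.
Qed.
Lemma qadd0 : left_id (qzero S) (@qadd A M S).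
Proof. by move=> v; have [y ->] := qpiP v; rewrite qzeroE qaddE add0r. Qed.
Lemma qaddN : left_inverse (qzero S) (@qopp A M S) (@qadd A M S).
Proof. by move=> v; have [y ->] := qpiP v; rewrite qoppE qzeroE qaddE addNr. Qed.

HB.instance Definition _ := GRing.isZmodule.Build (qmod S) qaddA qaddC qadd0 qaddN.

Lemma qpi0 : qpi 0 = 0. Proof. by rewrite -qzeroE. Qed.
Lemma qpiD : {morph qpi : u v / u + v}. Proof. by move=> u v; rewrite -qaddE. Qed.

Lemma qscaleA a b v : qscale a (qscale b v) = qscale (a * b) v :> qmod S.
Proof. by have [y ->] := qpiP v; rewrite !qscaleE scalerA. Qed.
Lemma qscale1 : left_id 1 (@qscale A M S).
Proof. by move=> v; have [y ->] := qpiP v; rewrite !qscaleE scale1r. Qed.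
Lemma qscaleDr : right_distributive (@qscale A M S) +%R.
Proof.
move=> a u v; have [x ->] := qpiP u; have [y ->] := qpiP v.
by rewrite -qpiD !qscaleE scalerDr qpiD.
Qed.
Lemma qscaleDl v : {morph (@qscale A M S)^~ v : a b / a + b}.
Proof. by move=> a b; have [y ->] := qpiP v; rewrite !qscaleE scalerDl qpiD. Qed.

HB.instance Definition _ := GRing.Zmodule_isLmodule.Build A (qmod S)
  qscaleA qscale1 qscaleDr qscaleDl.

Lemma qpiZ a v : qpi (a *: v) = a *: qpi v. Proof. by rewrite -qscaleE. Qed.

Lemma qpi_linear : linear qpi.
Proof. by move=> a u v; rewrite qpiD qpiZ. Qed.
HB.instance Definition _ :=
  GRing.isLinear.Build A M (qmod S) *:%R qpi qpi_linear.

(* The endomorphism of M / <S> induced by g, meaningful when g (<S>) <= <S> *)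
Definition qmap (g : M -> M) (v : qmod S) : qmod S := qpi (g (qrepr v)).

Lemma qmapE (g : M -> M) : {morph g : x y / x + y} ->
  (forall v, mspan S v -> mspan S (g v)) -> forall v, qmap g (qpi v) = qpi (g v).
Proof.
move=> gD gS v; apply/qpi_eq.
have gB x y : g (x - y) = g x - g y.
  by apply: (addIr (g y)); rewrite -gD !subrK.
by rewrite -gB; apply/gS/qpi_eq; rewrite qpiK.
Qed.

End Qmod.

Definition restr (A B : comNzRingType) (f : {rmorphism A -> B})
  (M : lmodType B) : Type := M.

Section Restr.
Variables (A B : comNzRingType) (f : {rmorphism A -> B}) (M : lmodType B).

HB.instance Definition _ := GRing.Zmodule.on (restr f M).

Definition rscale (a : A) (v : restr f M) : restr f M := f a *: (v : M).

Lemma rscaleA a b v : rscale a (rscale b v) = rscale (a * b) v.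
Proof. by rewrite /rscale scalerA rmorphM. Qed.
Lemma rscale1 : left_id 1 rscale.
Proof. by move=> v; rewrite /rscale rmorph1 scale1r. Qed.
Lemma rscaleDr : right_distributive rscale +%R.
Proof. by move=> a u v; rewrite /rscale scalerDr. Qed.
Lemma rscaleDl v : {morph rscale^~ v : a b / a + b}.
Proof. by move=> a b; rewrite /rscale rmorphD scalerDl. Qed.

HB.instance Definition _ := GRing.Zmodule_isLmodule.Build A (restr f M)
  rscaleA rscale1 rscaleDr rscaleDl.

Lemma restrE a (v : restr f M) : a *: v = (f a *: (v : M) : M).
Proof. by []. Qed.

End Restr.

(* The tensor product B (x)_A M : the free B-module on the set M modulo the
   relations [m + m'] = [m] + [m'] and [a m] = f(a) [m]. *)
Section ExtRel.
Variables (A B : comNzRingType) (f : {rmorphism A -> B}) (M : lmodType A).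

Definition extrel : set {freeg M / B} :=
  [set D | (exists m m', D = << m + m' >> - << m >> - << m' >>) \/
           (exists a m, D = << a *: m >> - f a *: << m >>)].
End ExtRel.
Arguments extrel {A B} f M.

Definition extscal (A B : comNzRingType) (f : {rmorphism A -> B})
  (M : lmodType A) : Type := qmod (extrel f M).

HB.lock Definition tens (A B : comNzRingType) (f : {rmorphism A -> B})
    (M : lmodType A) (b : B) (m : M) : extscal f M :=
  b *: (qpi (extrel f M) << m >> : qmod (extrel f M)).
Arguments tens {A B} f {M} b m.

(* The additive map b (x) m |-> g b m, for g additive in both variables and
   A-balanced; otherwise a junk function. *)
HB.lock Definition extlift (A B : comNzRingType) (f : {rmorphism A -> B})
    (M : lmodType A) (Z : zmodType) (g : B -> M -> Z) (v : extscal f M) : Z :=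
  let D : {freeg M / B} := qrepr (v : qmod (extrel f M)) in
  \sum_(m <- dom D) g (coeff m D) m.
Arguments extlift {A B} f {M Z} g v.

Section ExtScal.
Variables (A B : comNzRingType) (f : {rmorphism A -> B}) (M : lmodType A).

HB.instance Definition _ := GRing.Lmodule.on (extscal f M).

Local Notation tens := (tens f).

Lemma tensE b m : tens b m = b *: (qpi (extrel f M) << m >> : extscal f M).
Proof. by rewrite tens.unlock. Qed.

Lemma tensDl m : {morph tens^~ m : b c / b + c}.
Proof. by move=> b c; rewrite !tensE scalerDl. Qed.

Lemma tensDr b : {morph tens b : m n / m + n}.
Proof.
move=> m n; rewrite !tensE -scalerDr; congr (_ *: _).
rewrite -[RHS](raddfD (qpi (extrel f M))); apply/qpi_eq/sub_mspan.
by left; exists m, n; rewrite opprD addrA.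
Qed.

Lemma tensZl c b (m : M) : c *: tens b m = tens (c * b) m.
Proof. by rewrite !tensE scalerA. Qed.

Lemma tensZr b a (m : M) : tens b (a *: m) = tens (b * f a) m.
Proof.
rewrite !tensE -scalerA; congr (_ *: _).
rewrite -[RHS](linearZZ (qpi (extrel f M))); apply/qpi_eq/sub_mspan.
by right; exists a, m.
Qed.

Lemma tens_ind (P : extscal f M -> Prop) : P 0 ->
  (forall u v, P u -> P v -> P (u + v)) -> (forall b m, P (tens b m)) ->
  forall v, P v.
Proof.
move=> P0 PD Pt v; rewrite -(qpiK v) -[qrepr v]freeg_sumE raddf_sum.
elim/big_ind: _ => // m _.
have -> : << coeff m (qrepr v) *g m >> = coeff m (qrepr v) *: << m >> :> {freeg M / B}.
  by apply/eqP/freeg_eqP => x; rewrite coeffZ !coeffU mul1r.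
rewrite [X in P X](linearZZ (qpi (extrel f M))).
by have := Pt (coeff m (qrepr v)) m; rewrite tensE.
Qed.

Lemma tens_ext (Z : zmodType) (p q : extscal f M -> Z) :
  {morph p : u v / u + v} -> {morph q : u v / u + v} ->
  (forall b m, p (tens b m) = q (tens b m)) -> p =1 q.
Proof.
move=> pD qD pq; apply: tens_ind => [|u v pqu pqv|//]; last first.
  by rewrite pD qD pqu pqv.
have p0 : p 0 = 0 by apply: (addIr (p 0)); rewrite -pD !add0r.
by rewrite p0; apply: (addIr (q 0)); rewrite -qD !add0r.
Qed.

Section Lift.
Variables (Z : zmodType) (g : B -> M -> Z).

Definition flift (D : {freeg M / B}) : Z := \sum_(m <- dom D) g (coeff m D) m.
Local Notation extlift := (extlift f g).

Hypothesis gDl : forall m, {morph g^~ m : b c / b + c}.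
Hypothesis gDr : forall b, {morph g b : m n / m + n}.
Hypothesis gA : forall b a m, g b (a *: m) = g (b * f a) m.

Let g0 m : g 0 m = 0.
Proof. by apply: (addIr (g 0 m)); rewrite -gDl !add0r. Qed.

Let flift_sub D s : uniq s -> {subset dom D <= s} ->
  flift D = \sum_(m <- s) g (coeff m D) m.
Proof.
move=> us sub; rewrite (bigID (mem (dom D))) /= [X in _ + X]big1 ?addr0; last first.
  by move=> m; rewrite mem_dom negbK => /eqP ->.
rewrite -big_filter; apply: perm_big; apply: uniq_perm.
- exact: uniq_dom.
- exact: filter_uniq.
move=> m; rewrite mem_filter; case: (boolP (m \in dom D)) => //= mD.
by rewrite sub.
Qed.

Lemma fliftD : {morph flift : D E / D + E}.
Proof.
move=> D E; pose s := undup (dom D ++ dom E).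
have us : uniq s by apply: undup_uniq.
rewrite (@flift_sub (D + E) s) // ?(@flift_sub D s) // ?(@flift_sub E s) //.
- rewrite -big_split; apply: eq_bigr => m _ /=.
  by rewrite coeffD gDl.
- by move=> m; rewrite mem_undup mem_cat => ->; rewrite orbT.
- by move=> m; rewrite mem_undup mem_cat => ->.
- by move=> m /domD_subset; rewrite mem_undup.
Qed.

Lemma flift0 : flift 0 = 0.
Proof. by rewrite /flift dom0 big_nil. Qed.

Lemma fliftN D : flift (- D) = - flift D.
Proof. by apply: (addIr (flift D)); rewrite -fliftD !addNr flift0. Qed.

Lemma fliftU b m : flift << b *g m >> = g b m.
Proof.
have [->|b0] := eqVneq b 0; first by rewrite freegU0 flift0 g0.
by rewrite /flift domU // big_seq1 coeffU eqxx mulr1.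
Qed.

Lemma flift_rel D : mspan (extrel f M) D -> flift D = 0.
Proof.
have fgZ b c (m : M) : b *: << c *g m >> = << b * c *g m >> :> {freeg M / B}.
  by apply/eqP/freeg_eqP => x; rewrite coeffZ !coeffU mulrA.
suff H b E : extrel f M E -> flift (b *: E) = 0.
  move=> [n [a [x [Sx ->]]]]; elim/big_ind: _ => //; first exact: flift0.
    by move=> u v; rewrite fliftD => -> ->; rewrite addr0.
  by move=> i _; apply: H.
case=> [[m [n ->]]|[a [m ->]]].
  rewrite !scalerBr !fliftD !fliftN !fgZ !fliftU mulr1 gDr.
  by rewrite addrAC addrK subrr.
by rewrite scalerBr scalerA fliftD fliftN !fgZ !fliftU !mulr1 gA subrr.
Qed.

Lemma extlift_pi D : extlift (qpi (extrel f M) D) = flift D.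
Proof.
rewrite extlift.unlock; change (flift (qrepr (qpi (extrel f M) D)) = flift D).
apply/eqP; rewrite -subr_eq0 -fliftN -fliftD; apply/eqP/flift_rel/qpi_eq.
exact: qpiK.
Qed.

Lemma extliftD : {morph extlift : u v / u + v}.
Proof.
move=> u v; rewrite -(qpiK u) -(qpiK v) -[_ + _](raddfD (qpi _)).
by rewrite !extlift_pi fliftD.
Qed.

Lemma extliftE b m : extlift (tens b m) = g b m.
Proof.
rewrite !tensE -[_ *: _](linearZZ (qpi _)) extlift_pi -fliftU; congr flift.
by apply/eqP/freeg_eqP => x; rewrite coeffZ !coeffU mul1r.
Qed.

End Lift.
End ExtScal.

Record fps (A : Type) := Fps { fcoef :> nat -> A }.

Section Fps.
Variable A : comNzRingType.
Implicit Types (F G H : fps A) (a b : A) (n k : nat).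

HB.instance Definition _ := gen_eqMixin (fps A).
HB.instance Definition _ := gen_choiceMixin (fps A).

Lemma fpsP F G : F =1 G -> F = G.
Proof. by case: F G => [F] [G] /= FG; congr Fps; apply/funext. Qed.

Definition fpsC a : fps A := Fps (fun n => if n is 0 then a else 0).
Definition fps_add F G := Fps (fun n => F n + G n).
Definition fps_opp F := Fps (fun n => - F n).
Definition fps_mul F G := Fps (fun n => \sum_(i < n.+1) F i * G (n - i)%N).

Lemma fps_addA : associative fps_add.
Proof. by move=> F G H; apply: fpsP => n /=; rewrite addrA. Qed.
Lemma fps_addC : commutative fps_add.
Proof. by move=> F G; apply: fpsP => n /=; rewrite addrC. Qed.
Lemma fps_add0 : left_id (fpsC 0) fps_add.
Proof. by move=> F; apply: fpsP => -[|n] /=; rewrite add0r. Qed.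
Lemma fps_addN : left_inverse (fpsC 0) fps_opp fps_add.
Proof. by move=> F; apply: fpsP => -[|n] /=; rewrite addNr. Qed.

HB.instance Definition _ := GRing.isZmodule.Build (fps A)
  fps_addA fps_addC fps_add0 fps_addN.

Let tr n F : {poly A} := \poly_(i < n) F i.

Let tr_mul n F G i : (i < n)%N -> (fps_mul F G) i = (tr n F * tr n G)`_i.
Proof.
move=> lt_in; rewrite coefM /=; apply: eq_bigr => j _.
rewrite !coef_poly (leq_ltn_trans (leq_subr _ _) lt_in).
by rewrite (leq_ltn_trans _ lt_in) // -ltnS.
Qed.

Lemma fps_mulC : commutative fps_mul.
Proof.
by move=> F G; apply: fpsP => n; rewrite !(@tr_mul n.+1) // mulrC.
Qed.

Lemma fps_mul1 : left_id (fpsC 1) fps_mul.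
Proof.
move=> F; apply: fpsP => n /=; rewrite big_ord_recl /= mul1r subn0.
by rewrite big1 ?addr0 // => i _; rewrite mul0r.
Qed.

Lemma fps_mulDl : left_distributive fps_mul fps_add.
Proof.
move=> F G H; apply: fpsP => n /=; rewrite -big_split.
by apply: eq_bigr => i _; rewrite /= mulrDl.
Qed.

Lemma fps_mulA : associative fps_mul.
Proof.
move=> F G H; apply: fpsP => n.
have E P Q i : (i < n.+1)%N -> (tr n.+1 (fps_mul P Q))`_i = (tr n.+1 P * tr n.+1 Q)`_i.
  by move=> lt_in; rewrite coef_poly lt_in (@tr_mul n.+1).
rewrite !(@tr_mul n.+1) // [LHS]coefM.
transitivity ((tr n.+1 F * (tr n.+1 G * tr n.+1 H))`_n).
  by rewrite coefM; apply: eq_bigr => i _; rewrite E // ltnS leq_subr.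
by rewrite mulrA !coefM; apply: eq_bigr => i _; rewrite E.
Qed.

Lemma fps_1neq0 : fpsC 1 != 0.
Proof.
by apply/eqP => /(congr1 (fun F => F 0)) /= /eqP; rewrite oner_eq0.
Qed.

HB.instance Definition _ := GRing.Zmodule_isComNzRing.Build (fps A)
  fps_mulA fps_mulC fps_mul1 fps_mulDl fps_1neq0.

Lemma fpsD F G n : (F + G) n = F n + G n. Proof. by []. Qed.
Lemma fpsN F n : (- F) n = - F n. Proof. by []. Qed.
Lemma fps0 n : (0 : fps A) n = 0. Proof. by case: n. Qed.
Lemma fpsM F G n : (F * G) n = \sum_(i < n.+1) F i * G (n - i)%N.
Proof. by []. Qed.

Lemma fpsCM a F n : (fpsC a * F) n = a * F n.
Proof.
rewrite fpsM big_ord_recl /= subn0 big1 ?addr0 // => i _.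
by rewrite mul0r.
Qed.

Lemma fpsC_zmod : zmod_morphism fpsC.
Proof. by move=> a b; apply: fpsP => -[|n] //=; rewrite subr0. Qed.
Lemma fpsC_monoid : monoid_morphism fpsC.
Proof.
by split=> // a b; apply: fpsP => n; rewrite fpsCM; case: n => //= n; rewrite mulr0.
Qed.
HB.instance Definition _ := GRing.isZmodMorphism.Build A (fps A) fpsC fpsC_zmod.
HB.instance Definition _ := GRing.isMonoidMorphism.Build A (fps A) fpsC fpsC_monoid.

Definition fpsX : fps A := Fps (fun n => (n == 1%N)%:R).
Definition fshift k F : fps A := Fps (fun n => if (n < k)%N then 0 else F (n - k)%N).
Definition ftheta F : fps A := Fps (fun n => F n *+ n).

Lemma fshiftM k F G : fshift k F * G = fshift k (F * G).
Proof.
apply: fpsP => n; rewrite fpsM /=; case: ltnP => nk.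
  by rewrite big1 // => i _; rewrite (leq_ltn_trans _ nk) ?mul0r // -ltnS.
rewrite -(big_mkord xpredT (fun i => (if (i < k)%N then 0 else F (i - k)%N) * G (n - i)%N)).
rewrite (@big_cat_nat _ _ _ k) //=; last by rewrite ltnW.
rewrite big_nat big1 ?add0r; last by move=> i /andP[_ ->]; rewrite mul0r.
rewrite -{1}(add0n k) big_addn subSn // big_mkord.
apply: eq_bigr => i _; rewrite addnK ltnNge leq_addl /=.
by rewrite addnC subnDA.
Qed.

Lemma fshiftD k F G : fshift k (F + G) = fshift k F + fshift k G.
Proof. by apply: fpsP => n /=; case: ifP; rewrite ?addr0. Qed.

Lemma fshift_shift k l F : fshift k (fshift l F) = fshift (k + l) F.
Proof.
apply: fpsP => n /=; case: ltnP => nk; first by rewrite (ltn_addr _ nk).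
by rewrite ltn_subLR // subnDA.
Qed.

Lemma fthetaD : {morph ftheta : F G / F + G}.
Proof. by move=> F G; apply: fpsP => n /=; rewrite mulrnDl. Qed.

Lemma fthetaM F G : ftheta (F * G) = ftheta F * G + F * ftheta G.
Proof.
apply: fpsP => n; rewrite fpsD !fpsM /= -sumrMnl -big_split.
apply: eq_bigr => i _ /=; rewrite mulrnAl mulrnAr -mulrnDr.
by rewrite subnKC // -ltnS.
Qed.

Lemma fthetaC a : ftheta (fpsC a) = 0.
Proof. by apply: fpsP => -[|n] //=; rewrite mul0rn. Qed.

Lemma fthetaX : ftheta fpsX = fpsX.
Proof. by apply: fpsP => -[|[|n]] /=; rewrite ?mulr0n ?mulr1n ?mul0rn. Qed.

End Fps.
Arguments fpsX {A}.

Section MapFps.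
Variables (A B : comNzRingType) (f : {rmorphism A -> B}).

Definition map_fps (F : fps A) : fps B := Fps (fun n => f (F n)).

Lemma map_fps_zmod : zmod_morphism map_fps.
Proof. by move=> F G; apply: fpsP => n /=; rewrite rmorphB. Qed.
Lemma map_fps_monoid : monoid_morphism map_fps.
Proof.
split=> [|F G]; apply: fpsP => n.
  by case: n => [|n] /=; rewrite ?rmorph1 ?rmorph0.
by rewrite [LHS]rmorph_sum; apply: eq_bigr => i _; rewrite rmorphM.
Qed.
HB.instance Definition _ :=
  GRing.isZmodMorphism.Build (fps A) (fps B) map_fps map_fps_zmod.
HB.instance Definition _ :=
  GRing.isMonoidMorphism.Build (fps A) (fps B) map_fps map_fps_monoid.

Lemma map_fpsC a : map_fps (fpsC a) = fpsC (f a).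
Proof. by apply: fpsP => -[|n] //=; rewrite rmorph0. Qed.
Lemma map_fps_theta F : map_fps (ftheta F) = ftheta (map_fps F).
Proof. by apply: fpsP => n /=; rewrite rmorphMn. Qed.
Lemma map_fps_shift k F : map_fps (fshift k F) = fshift k (map_fps F).
Proof. by apply: fpsP => n /=; case: ifP; rewrite ?rmorph0. Qed.

End MapFps.

(* A((x)) as two-sided sequences that vanish far enough to the left *)
Record laurent (A : nmodType) := Laurent {
  lcoef :> int -> A;
  laurent_bounded : exists N : nat, forall i : int, i < - N%:Z -> lcoef i = 0 }.

Section Laurent.
Variable A : comNzRingType.
Implicit Types (F G H : fps A) (f g h : laurent A) (N M k : nat) (i : int).

HB.instance Definition _ := gen_eqMixin (laurent A).
HB.instance Definition _ := gen_choiceMixin (laurent A).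

Lemma laurentP f g : f =1 g -> f = g.
Proof.
case: f g => [f pf] [g pg] /= /funext fg; case: _ / fg in pg *.
by congr Laurent; apply: Prop_irrelevance.
Qed.

Definition zcoef F i : A := if i is Posz n then F n else 0.

Lemma lau_bounded N F :
  exists P : nat, forall i, i < - P%:Z -> zcoef F (i + N%:Z) = 0.
Proof.
exists N => i; rewrite -subr_lt0 opprK; by case: (i + N%:Z) => //.
Qed.

(* x^-N F *)
Definition lau N F : laurent A := Laurent (lau_bounded N F).

Lemma lau_shift N k F : lau (N + k) (fshift k F) = lau N F.
Proof.
apply: laurentP => i /=; rewrite PoszD addrA.
case: (i + N%:Z) => [n|n] /=; first by rewrite ltnNge leq_addl /= addnK.
case: (leqP k n) => [nk|nk].
  have -> : Negz n + k%:Z = Negz (n - k) by rewrite !NegzE; lia.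
  by [].
have -> : Negz n + k%:Z = Posz (k - n.+1) by rewrite !NegzE; lia.
rewrite /=; case: ifP => //; lia.
Qed.

Lemma lau_inj N : injective (lau N).
Proof.
move=> F G /(congr1 (fun f => f : int -> A)) E; apply: fpsP => n.
have := congr1 (fun u => u (n%:Z - N%:Z)) E.
by rewrite /= subrK.
Qed.

Definition lorder f : nat := projT1 (cid (laurent_bounded f)).

(* the coefficients of x^N f, when this is a power series *)
Definition lnum N f : fps A := Fps (fun n => f (n%:Z - N%:Z)).

Lemma lnumK N f : (lorder f <= N)%N -> lau N (lnum N f) = f.
Proof.
rewrite /lorder; case: cid => P fP /= PN; apply: laurentP => i /=.
case E : (i + N%:Z) => [n|n] /=; first by rewrite -E addrK.
by rewrite fP //; move: E; rewrite NegzE; lia.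
Qed.

Lemma lau_ex f g h : exists N F G H, [/\ f = lau N F, g = lau N G & h = lau N H].
Proof.
pose N := (lorder f + lorder g + lorder h)%N.
exists N, (lnum N f), (lnum N g), (lnum N h).
by rewrite !lnumK // /N; lia.
Qed.

Lemma lau_ex1 f : exists N F, f = lau N F.
Proof. by exists (lorder f), (lnum (lorder f) f); rewrite lnumK. Qed.

Lemma laurent0_bounded : exists N : nat, forall i : int, i < - N%:Z -> (0 : A) = 0.
Proof. by exists 0%N. Qed.
Definition laurent0 : laurent A := Laurent laurent0_bounded.

Lemma laurent_add_bounded f g :
  exists N : nat, forall i : int, i < - N%:Z -> f i + g i = 0.
Proof.
have [N fN] := laurent_bounded f; have [M gM] := laurent_bounded g.
exists (N + M)%N => i iNM; rewrite fN ?gM ?addr0 //; lia.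
Qed.
Definition laurent_add f g : laurent A := Laurent (laurent_add_bounded f g).

Lemma laurent_opp_bounded f :
  exists N : nat, forall i : int, i < - N%:Z -> - f i = 0.
Proof.
have [N fN] := laurent_bounded f; exists N => i iN; rewrite fN ?oppr0 //.
Qed.
Definition laurent_opp f : laurent A := Laurent (laurent_opp_bounded f).

(* (x^-N F) (x^-M G) = x^-(N+M) (F G); see lau_mulE *)
Definition laurent_mul f g : laurent A :=
  lau (lorder f + lorder g) (lnum (lorder f) f * lnum (lorder g) g).

Lemma laurent_addA : associative laurent_add.
Proof. by move=> f g h; apply: laurentP => i /=; rewrite addrA. Qed.
Lemma laurent_addC : commutative laurent_add.
Proof. by move=> f g; apply: laurentP => i /=; rewrite addrC. Qed.
Lemma laurent_add0 : left_id laurent0 laurent_add.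
Proof. by move=> f; apply: laurentP => i /=; rewrite add0r. Qed.
Lemma laurent_addN : left_inverse laurent0 laurent_opp laurent_add.
Proof. by move=> f; apply: laurentP => i /=; rewrite addNr. Qed.

HB.instance Definition _ := GRing.isZmodule.Build (laurent A)
  laurent_addA laurent_addC laurent_add0 laurent_addN.

Lemma lau_addE N F G : lau N F + lau N G = lau N (F + G).
Proof.
by apply: laurentP => i /=; case: (i + N%:Z) => //= n; rewrite addr0.
Qed.

Lemma lau_eq N M F G : lau N F = lau M G -> fshift M F = fshift N G.
Proof. by rewrite -(lau_shift N M) -(lau_shift M N) addnC => /lau_inj. Qed.

Lemma lau_mulE N M F G : laurent_mul (lau N F) (lau M G) = lau (N + M) (F * G).
Proof.
rewrite /laurent_mul; set p := lorder _; set q := lorder (lau M G).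
set F' := lnum p _; set G' := lnum q _.
have EF : fshift N F' = fshift p F by apply: lau_eq; rewrite lnumK.
have EG : fshift M G' = fshift q G by apply: lau_eq; rewrite lnumK.
have sM k l P Q : fshift (k + l) (P * Q) = fshift k P * fshift l Q :> fps A.
  by rewrite -fshift_shift -[P * Q]mulrC -fshiftM mulrC -fshiftM mulrC.
rewrite -(lau_shift _ (N + M)) -[RHS](lau_shift _ (p + q)) addnC.
by rewrite !sM EF EG.
Qed.

Lemma laurent_mulA : associative laurent_mul.
Proof.
move=> f g h; have [N [F [G [H [-> -> ->]]]]] := lau_ex f g h.
by rewrite !lau_mulE mulrA addnA.
Qed.

Lemma laurent_mulC : commutative laurent_mul.
Proof.
move=> f g; have [N [F [G [H [-> -> _]]]]] := lau_ex f g g.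
by rewrite !lau_mulE mulrC.
Qed.

Lemma laurent_mul1 : left_id (lau 0 1) laurent_mul.
Proof.
by move=> f; have [N [F ->]] := lau_ex1 f; rewrite lau_mulE mul1r.
Qed.

Lemma laurent_mulDl : left_distributive laurent_mul +%R.
Proof.
move=> f g h; have [N [F [G [H [-> -> ->]]]]] := lau_ex f g h.
by rewrite lau_addE !lau_mulE lau_addE mulrDl.
Qed.

Lemma laurent_1neq0 : lau 0 1 != 0.
Proof.
apply/eqP => /(congr1 (fun f => lcoef f 0)) /= /eqP.
by rewrite oner_eq0.
Qed.

HB.instance Definition _ := GRing.Zmodule_isComNzRing.Build (laurent A)
  laurent_mulA laurent_mulC laurent_mul1 laurent_mulDl laurent_1neq0.

Lemma lauD N F G : lau N (F + G) = lau N F + lau N G.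
Proof. by rewrite lau_addE. Qed.
Lemma lauM N M F G : lau N F * lau M G = lau (N + M) (F * G).
Proof. exact: lau_mulE. Qed.
Lemma lcoefD f g i : (f + g) i = f i + g i. Proof. by []. Qed.
Lemma lcoefN f i : (- f) i = - f i. Proof. by []. Qed.
Lemma lcoef0 i : (0 : laurent A) i = 0. Proof. by []. Qed.

Definition fps_lau F : laurent A := lau 0 F.

Lemma fps_lau_zmod : zmod_morphism fps_lau.
Proof.
move=> F G; apply: (addIr (fps_lau G)).
by rewrite subrK /fps_lau lau_addE subrK.
Qed.
Lemma fps_lau_monoid : monoid_morphism fps_lau.
Proof. by split=> // F G; rewrite /fps_lau lauM. Qed.
HB.instance Definition _ :=
  GRing.isZmodMorphism.Build (fps A) (laurent A) fps_lau fps_lau_zmod.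
HB.instance Definition _ :=
  GRing.isMonoidMorphism.Build (fps A) (laurent A) fps_lau fps_lau_monoid.

Definition laurC (a : A) : laurent A := fps_lau (fpsC a).

Lemma laurC_zmod : zmod_morphism laurC.
Proof. by move=> a b; rewrite /laurC !rmorphB. Qed.
Lemma laurC_monoid : monoid_morphism laurC.
Proof. by split=> [|a b]; rewrite /laurC ?rmorph1 ?rmorphM. Qed.
HB.instance Definition _ :=
  GRing.isZmodMorphism.Build A (laurent A) laurC laurC_zmod.
HB.instance Definition _ :=
  GRing.isMonoidMorphism.Build A (laurent A) laurC laurC_monoid.

Lemma ltheta_bounded f :
  exists N : nat, forall i : int, i < - N%:Z -> f i *~ i = 0.
Proof.
by have [N fN] := laurent_bounded f; exists N => i iN; rewrite fN ?mul0rz.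
Qed.
Definition ltheta f : laurent A := Laurent (ltheta_bounded f).

Lemma lthetaD : {morph ltheta : f g / f + g}.
Proof. by move=> f g; apply: laurentP => i /=; rewrite mulrzDl. Qed.

Lemma ltheta_lau N F : ltheta (lau N F) = lau N (ftheta F - F *+ N).
Proof.
have MN n : (F *+ N) n = F n *+ N.
  by elim: N => [|k IH]; rewrite ?mulr0n ?fps0 // !mulrS fpsD IH.
apply: laurentP => i /=; case E : (i + N%:Z) => [n|n] /=; last by rewrite mul0rz.
rewrite MN; have -> : i = n%:Z - N%:Z by rewrite -E addrK.
by rewrite mulrzBr.
Qed.

Lemma lthetaM f g : ltheta (f * g) = ltheta f * g + f * ltheta g.
Proof.
have [N [F [G [_ [-> -> _]]]]] := lau_ex f g g.
rewrite lauM !ltheta_lau !lauM lau_addE fthetaM; congr lau.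
by rewrite mulrBl mulrBr mulrnAl mulrnAr addrACA -opprD -mulrnDr.
Qed.

Lemma ltheta_fps F : ltheta (fps_lau F) = fps_lau (ftheta F).
Proof. by rewrite /fps_lau ltheta_lau mulr0n subr0. Qed.

End Laurent.

Section MapLaurent.
Variables (A B : comNzRingType) (f : {rmorphism A -> B}).

Lemma map_lau_bounded (F : laurent A) :
  exists N : nat, forall i : int, i < - N%:Z -> f (F i) = 0.
Proof.
by have [N FN] := laurent_bounded F; exists N => i iN; rewrite FN ?rmorph0.
Qed.
Definition map_lau (F : laurent A) : laurent B := Laurent (map_lau_bounded F).

Lemma map_lauE N F : map_lau (lau N F) = lau N (map_fps f F).
Proof.
by apply: laurentP => i /=; case: (i + N%:Z) => //= n; rewrite rmorph0.
Qed.

Lemma map_lau_zmod : zmod_morphism map_lau.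
Proof. by move=> F G; apply: laurentP => i /=; rewrite rmorphB. Qed.
Lemma map_lau_monoid : monoid_morphism map_lau.
Proof.
split=> [|F G]; first by rewrite [LHS](map_lauE 0) rmorph1.
have [N [F' [G' [_ [-> -> _]]]]] := lau_ex F G G.
by rewrite lauM !map_lauE rmorphM lauM.
Qed.
HB.instance Definition _ :=
  GRing.isZmodMorphism.Build (laurent A) (laurent B) map_lau map_lau_zmod.
HB.instance Definition _ :=
  GRing.isMonoidMorphism.Build (laurent A) (laurent B) map_lau map_lau_monoid.

Lemma map_laurC a : map_lau (laurC a) = laurC (f a).
Proof. by rewrite [LHS](map_lauE 0) map_fpsC. Qed.
Lemma map_lau_theta F : map_lau (ltheta F) = ltheta (map_lau F).
Proof. by apply: laurentP => i /=; rewrite rmorphMz. Qed.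

End MapLaurent.

Section Ideals.
Variable A : comNzRingType.
Implicit Types I J : set A.

Definition is_ideal I := [/\ I 0, forall a b, I a -> I b -> I (a + b) &
  forall a b, I b -> I (a * b)].

Definition maximal_ideal I :=
  [/\ is_ideal I, ~ I 1 & forall J, is_ideal J -> ~ J 1 -> I `<=` J -> J = I].

Definition local_ring_with I :=
  maximal_ideal I /\ forall J, maximal_ideal J -> J = I.

Definition noetherian := forall I, is_ideal I ->
  exists n (e : 'I_n -> A), I = mspan (range e : set A^o).

Fixpoint ideal_exp I k : set A :=
  if k is k'.+1 then idmul I (ideal_exp I k' : set A^o) else setT.

(* A -> lim_k A / I^k is injective and surjective *)
Definition adically_complete I :=
  (forall a, (forall k, ideal_exp I k a) -> a = 0) /\
  (forall u : nat -> A, (forall k, ideal_exp I k (u k.+1 - u k)) ->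
     exists a, forall k, ideal_exp I k (a - u k)).

Lemma mspan_ideal (S : set A^o) : is_ideal (mspan S).
Proof.
by split; [exact: mspan0 | exact: (@mspanD _ A^o) | exact: (@mspanZ _ A^o)].
Qed.

Lemma ideal_exp_ideal I k : is_ideal (ideal_exp I k).
Proof. by case: k => [|k] //; apply: mspan_ideal. Qed.

Lemma ideal_exp_sub I k : is_ideal I -> ideal_exp I k.+1 `<=` I.
Proof.
case=> I0 ID IM; apply: (@mspan_min _ A^o) => // _ [a [m [Ia _ ->]]].
by rewrite -[_ *: _]/(a * m) mulrC; apply: IM.
Qed.

Lemma ideal_sum I n (x : 'I_n -> A) : is_ideal I ->
  (forall i, I (x i)) -> I (\sum_i x i).
Proof. by case=> I0 ID _ Ix; elim/big_ind: _. Qed.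

End Ideals.

(* The complete local noetherian C-algebras (R, r) with C -> R / r bijective *)
Record cnlAlg (C : fieldType) := CnlAlg {
  cnl_alg :> comAlgType C;
  cnl_max : set cnl_alg;
  cnl_local : local_ring_with cnl_max;
  cnl_noetherian : noetherian cnl_alg;
  cnl_complete : adically_complete cnl_max;
  cnl_residue : forall a : cnl_alg, exists! c : C, cnl_max (a - c%:A) }.
Arguments cnl_max {C} _.
Arguments cnl_local {C} _.
Arguments cnl_noetherian {C} _.
Arguments cnl_complete {C} _.
Arguments cnl_residue {C} _.

Section Trunc.
Variables (C : fieldType) (R : cnlAlg C).
Local Notation r := (cnl_max R).

Definition trunc_ideal k : {pred R} := fun a => `[< ideal_exp r k.+1 a >].

Lemma trunc_idealP k a : reflect (ideal_exp r k.+1 a) (a \in trunc_ideal k).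
Proof. exact: asboolP. Qed.

Lemma cnl_max_ideal : is_ideal r.
Proof. by case: (cnl_local R) => -[]. Qed.

Lemma trunc_idealr_closed k : idealr_closed (trunc_ideal k).
Proof.
have [I0 ID IM] := ideal_exp_ideal r k.+1; split; first exact/trunc_idealP.
  apply/trunc_idealP => /(ideal_exp_sub cnl_max_ideal).
  by case: (cnl_local R) => -[].
by move=> a u v /trunc_idealP Iu /trunc_idealP Iv; apply/trunc_idealP/ID/Iv/IM.
Qed.
HB.instance Definition _ k :=
  isIdealr.Build R (trunc_ideal k) (trunc_idealr_closed k).

(* R_k = R / r^(k+1) *)
Definition trunc k : Type := @Quotient.quot R (trunc_ideal k).

HB.instance Definition _ k := GRing.ComNzRing.on (trunc k).
HB.instance Definition _ k := Quotient.on (trunc k).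

Definition tpi k (a : R) : trunc k := \pi_(trunc k) a.

Lemma tpi_eq k a b : tpi k a = tpi k b <-> ideal_exp r k.+1 (a - b).
Proof.
have E : (a - b \in trunc_ideal k) = (tpi k a == tpi k b).
  exact: (Quotient.idealrBE (trunc_ideal k)).
by split=> [/eqP|/trunc_idealP];
  [rewrite -E => /trunc_idealP | rewrite E => /eqP].
Qed.

Lemma tpiK k (l : trunc k) : tpi k (repr l) = l.
Proof. exact: reprK. Qed.

Lemma tpi_zmod k : zmod_morphism (tpi k).
Proof. exact: (@pi_is_zmod_morphism R _ _ (@Quotient.quot R (trunc_ideal k))). Qed.
Lemma tpi_monoid k : monoid_morphism (tpi k).
Proof. exact: (@pi_is_monoid_morphism R _ _ (@Quotient.quot R (trunc_ideal k))). Qed.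
HB.instance Definition _ k :=
  GRing.isZmodMorphism.Build R (trunc k) (tpi k) (tpi_zmod k).
HB.instance Definition _ k :=
  GRing.isMonoidMorphism.Build R (trunc k) (tpi k) (tpi_monoid k).

Section Algebra.
Variable k : nat.

Definition tscale (c : C) (l : trunc k) : trunc k := tpi k c%:A * l.

Lemma tscaleA c d l : tscale c (tscale d l) = tscale (c * d) l.
Proof.
by rewrite /tscale mulrA -rmorphM -[c%:A * _]scalerAl mul1r scalerA.
Qed.
Lemma tscale1 : left_id 1 tscale.
Proof. by move=> l; rewrite /tscale scale1r rmorph1 mul1r. Qed.
Lemma tscaleDr : right_distributive tscale +%R.
Proof. by move=> c l m; rewrite /tscale mulrDr. Qed.
Lemma tscaleDl l : {morph tscale^~ l : c d / c + d}.
Proof. by move=> c d; rewrite /tscale scalerDl rmorphD mulrDl. Qed.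
HB.instance Definition _ := GRing.Zmodule_isLmodule.Build C (trunc k)
  tscaleA tscale1 tscaleDr tscaleDl.

Lemma tscaleAl c (l m : trunc k) : c *: (l * m) = c *: l * m.
Proof. exact: mulrA. Qed.
HB.instance Definition _ := GRing.Lmodule_isLalgebra.Build C (trunc k) tscaleAl.
HB.instance Definition _ := GRing.Lalgebra_isComAlgebra.Build C (trunc k).

Lemma tscaleE c (l : trunc k) : c *: l = tpi k c%:A * l. Proof. by []. Qed.

End Algebra.

Lemma cnl_cofinite k : exists n (e : 'I_n -> R), forall a, exists x : 'I_n -> C,
  ideal_exp r k (a - \sum_i (x i)%:A * e i).
Proof.
elim: k => [|k [n [e IH]]]; first by exists 0, (fun=> 0) => a; exists (fun=> 0).
have [p [b Eb]]   := cnl_noetherian R _ (ideal_exp_ideal r k).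
exists (n + p)%N, (fun i => match fintype.split i with inl j => e j | inr j => b j end).
move=> a; have [x] := IH a; rewrite Eb => /(@mspan_rangeP _ R^o) [y Ey].
have /choice[z Hz] : forall j, exists c : C, r (y j - c%:A).
  by move=> j; have [c [rc _]] := cnl_residue R (y j); exists c.
exists (fun i => match fintype.split i with inl j => x j | inr j => z j end).
rewrite big_split_ord /= opprD addrA.
under eq_bigr do rewrite (unsplitK (inl _)).
under [X in _ - X]eq_bigr do rewrite (unsplitK (inr _)).
rewrite Ey -sumrB; apply: (ideal_sum (ideal_exp_ideal r k.+1)) => j.
have Ib : ideal_exp r k (b j) by rewrite Eb; apply: (@sub_mspan _ R^o); exists j.
rewrite -[_ *: _]/(y j * b j) -mulrBl; apply: (@sub_mspan _ R^o).
by exists (y j - (z j)%:A), (b j).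
Qed.

End Trunc.

(* Modules with connection over an algebra A with structure map c and
   derivation d; MC(R((x))/R) and MC_log(R[[x]]/R) are instances. *)
Section Conn.
Variables (K A : comNzRingType) (c : {rmorphism K -> A}) (d : A -> A).

Record conn := Conn {
  conn_sort :> lmodType A;
  nabla : conn_sort -> conn_sort;
  conn_fin : fin_gen conn_sort;
  nablaD : {morph nabla : m n / m + n};
  nablaK : forall (a : K) m, nabla (c a *: m) = c a *: nabla m;
  nablaM : forall f m, nabla (f *: m) = d f *: m + f *: nabla m }.

Record chom (E F : conn) := Chom {
  chom_fun :> {linear E -> F};
  chom_nabla : forall m, chom_fun (nabla m) = nabla (chom_fun m) }.

Definition is_iso (E F : conn) (f : chom E F) :=
  exists g : chom F E, cancel f g /\ cancel g f.

(* (c, alpha) with alpha : L -> End(c) a morphism of K-algebras *)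
Record connAct (L : comAlgType K) := ConnAct {
  ca_obj :> conn;
  ca_act : L -> chom ca_obj ca_obj;
  ca_act1 : forall m, ca_act 1 m = m;
  ca_actM : forall l l' m, ca_act (l * l') m = ca_act l (ca_act l' m);
  ca_actD : forall l l' m, ca_act (l + l') m = ca_act l m + ca_act l' m;
  ca_actZ : forall a l m, ca_act (a *: l) m = c a *: ca_act l m }.

End Conn.

Definition MClog (K : comNzRingType) := conn (@fpsC K) (@ftheta K).
Definition MC (K : comNzRingType) := conn (@laurC K) (@ltheta K).
Definition MClogAct (K : comNzRingType) (L : comAlgType K) :=
  connAct (@fpsC K) (@ftheta K) L.
Definition MCAct (K : comNzRingType) (L : comAlgType K) :=
  connAct (@laurC K) (@ltheta K) L.

Section Gamma.
Variable K : comNzRingType.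

Section Obj.
Variable E : MClog K.

Definition gamma_nabla : extscal (@fps_lau K) E -> extscal (@fps_lau K) E :=
  extlift (@fps_lau K) (fun b m => tens (@fps_lau K) (ltheta b) m + tens (@fps_lau K) b (nabla m)).

Lemma gamma_nablaD : {morph gamma_nabla : u v / u + v}.
Proof.
apply: extliftD => [m b b'|b m m'|b a m].
- by rewrite lthetaD !tensDl addrACA.
- by rewrite nablaD !tensDr addrACA.
- rewrite nablaM tensDr !tensZr lthetaM tensDl ltheta_fps.
  by rewrite -addrA; congr (_ + _).
Qed.

Lemma gamma_nablaE b m : gamma_nabla (tens _ b m) =
  tens (@fps_lau K) (ltheta b) m + tens (@fps_lau K) b (nabla m).
Proof.
rewrite /gamma_nabla extliftE // => {b m} [m b b'|b m m'|b a m].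
- by rewrite lthetaD !tensDl addrACA.
- by rewrite nablaD !tensDr addrACA.
- rewrite nablaM tensDr !tensZr lthetaM tensDl ltheta_fps.
  by rewrite -addrA; congr (_ + _).
Qed.

Lemma gamma_nablaM f v : gamma_nabla (f *: v) = ltheta f *: v + f *: gamma_nabla v.
Proof.
elim/tens_ind: v => [|u v IHu IHv|b m].
- have g0 : gamma_nabla 0 = 0.
    by apply: (addIr (gamma_nabla 0)); rewrite -gamma_nablaD !add0r.
  by rewrite !scaler0 g0 scaler0 addr0.
- by rewrite [f *: _]scalerDr !gamma_nablaD IHu IHv !scalerDr addrACA.
rewrite tensZl !gamma_nablaE lthetaM tensDl scalerDr !tensZl.
by rewrite addrA.
Qed.

Lemma gamma_nablaK (a : K) v :
  gamma_nabla (laurC a *: v) = laurC a *: gamma_nabla v.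
Proof.
by rewrite gamma_nablaM ltheta_fps fthetaC rmorph0 scale0r add0r.
Qed.

Lemma gamma_fin : fin_gen (extscal (@fps_lau K) E).
Proof.
have [n [e eE]] := conn_fin E; exists n, (fun i => tens _ 1 (e i)).
apply/seteqP; split=> // v _; elim/tens_ind: v => [|u v|b m].
- exact: mspan0.
- exact: mspanD.
have /mspan_rangeP[a ->] : mspan (range e) m by rewrite eE.
have tens_sum p (x : 'I_p -> E) :
    tens (@fps_lau K) b (\sum_i x i) = \sum_i tens (@fps_lau K) b (x i).
  have t0 : tens (@fps_lau K) b (0 : E) = 0.
    by apply: (addIr (tens _ b 0)); rewrite -tensDr !add0r.
  exact: (big_morph _ (tensDr _ _) t0).
rewrite tens_sum; apply: mspan_sum => i.
have -> : tens (@fps_lau K) b (a i *: e i) =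
    (b * fps_lau (a i)) *: tens (@fps_lau K) 1 (e i).
  by rewrite tensZr tensZl mulr1.
by apply: mspanZ; apply: sub_mspan; exists i.
Qed.

Definition gamma : MC K :=
  Conn gamma_fin gamma_nablaD gamma_nablaK gamma_nablaM.

End Obj.

Section Map.
Variables (E F : MClog K) (g : chom E F).

Definition gamma_fun : extscal (@fps_lau K) E -> extscal (@fps_lau K) F :=
  extlift (@fps_lau K) (fun b m => tens (@fps_lau K) b (g m)).

Lemma gamma_funE b m : gamma_fun (tens _ b m) = tens (@fps_lau K) b (g m).
Proof.
rewrite /gamma_fun extliftE // => {b m} [m b b'|b m m'|b a m].
- by rewrite tensDl.
- by rewrite raddfD tensDr.
- by rewrite linearZ tensZr.
Qed.

Lemma gamma_funD : {morph gamma_fun : u v / u + v}.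
Proof.
apply: extliftD => [m b b'|b m m'|b a m].
- by rewrite tensDl.
- by rewrite raddfD tensDr.
- by rewrite linearZ tensZr.
Qed.

Lemma gamma_fun_linear : linear gamma_fun.
Proof.
have g0 : gamma_fun 0 = 0.
  by apply: (addIr (gamma_fun 0)); rewrite -gamma_funD !add0r.
have gZ f v : gamma_fun (f *: v) = f *: gamma_fun v.
  elim/tens_ind: v => [|u v IHu IHv|b m].
  - by rewrite scaler0 g0 scaler0.
  - by rewrite scalerDr !gamma_funD IHu IHv scalerDr.
  by rewrite tensZl !gamma_funE tensZl.
by move=> f u v; rewrite gamma_funD gZ.
Qed.
HB.instance Definition _ := GRing.isLinear.Build (laurent K)
  (extscal (@fps_lau K) E) (extscal (@fps_lau K) F) *:%R gamma_fun gamma_fun_linear.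

Lemma gamma_fun_nabla v : gamma_fun (gamma_nabla v) = gamma_nabla (gamma_fun v).
Proof.
elim/tens_ind: v => [|u v IHu IHv|b m].
- have n0 X : @gamma_nabla X 0 = 0.
    by apply: (addIr (gamma_nabla 0)); rewrite -gamma_nablaD !add0r.
  by rewrite raddf0 !n0 raddf0.
- by rewrite gamma_nablaD !gamma_funD gamma_nablaD IHu IHv.
by rewrite gamma_nablaE gamma_funD !gamma_funE gamma_nablaE chom_nabla.
Qed.

Definition gamma_map : chom (gamma E) (gamma F) :=
  @Chom _ _ _ _ (gamma E) (gamma F) gamma_fun gamma_fun_nabla.

End Map.

Section Act.
Variables (L : comAlgType K) (N : MClogAct L).

Definition gamma_act (l : L) : chom (gamma N) (gamma N) := gamma_map (ca_act N l).

Let actDr l : {morph gamma_act l : u v / u + v}.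
Proof. exact: gamma_funD. Qed.
Let actE l b m : gamma_act l (tens _ b m) = tens (@fps_lau K) b (ca_act N l m).
Proof. exact: gamma_funE. Qed.

Lemma gamma_act1 m : gamma_act 1 m = m.
Proof.
apply: (tens_ext (actDr 1) (q := id)) m => // b m.
by rewrite actE ca_act1.
Qed.

Lemma gamma_actM l l' m : gamma_act (l * l') m = gamma_act l (gamma_act l' m).
Proof.
apply: (tens_ext (actDr _) (q := gamma_act l \o gamma_act l')) m => [u v|b m].
  by rewrite /comp !actDr.
by rewrite /comp !actE ca_actM.
Qed.

Lemma gamma_actD l l' m : gamma_act (l + l') m = gamma_act l m + gamma_act l' m.
Proof.
apply: (tens_ext (actDr _) (q := fun m => gamma_act l m + gamma_act l' m)) m.
  by move=> u v; rewrite !actDr addrACA.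
by move=> b m; rewrite !actE ca_actD tensDr.
Qed.

Lemma gamma_actZ a l m : gamma_act (a *: l) m = laurC a *: gamma_act l m.
Proof.
apply: (tens_ext (actDr _) (q := fun m => laurC a *: gamma_act l m)) m.
  by move=> u v; rewrite actDr scalerDr.
by move=> b m; rewrite !actE ca_actZ tensZr mulrC -tensZl.
Qed.

Definition gammaAct : MCAct L := ConnAct gamma_act1 gamma_actM gamma_actD gamma_actZ.

End Act.
End Gamma.

(* An isomorphism phi : gamma E ~ M makes E a logarithmic model of M *)
Definition log_model (K : comNzRingType) (M : MC K) (E : MClog K)
  (phi : chom (gamma E) M) := is_iso phi.

Definition regular_singular (K : comNzRingType) (M : MC K) :=
  exists (E : MClog K) (phi : chom (gamma E) M), log_model phi.

Section Reduction.
Variables (C : fieldType) (R : cnlAlg C) (AC AR : comNzRingType).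
Variables (cC : {rmorphism C -> AC}) (cR : {rmorphism R -> AR}).
Variables (dC : AC -> AC) (dR : AR -> AR) (f : {rmorphism AC -> AR}).
Hypothesis f_const : forall a, f (cC a) = cR a%:A.
Hypothesis f_der : forall u, f (dC u) = dR (f u).
Hypothesis f_fin : forall k, exists n (e : 'I_n -> AR), forall u,
  exists (x : 'I_n -> AC) p (b : 'I_p -> R) (t : 'I_p -> AR),
    (forall j, ideal_exp (cnl_max R) k.+1 (b j)) /\
    u = \sum_i f (x i) * e i + \sum_j cR (b j) * t j.

Variables (M : conn cR dR) (k : nat).
Local Notation r := (cnl_max R).

(* generators of r^(k+1) M *)
Definition red_rel : set M :=
  [set v | exists a m, ideal_exp r k.+1 a /\ v = cR a *: m].

Local Notation red_sort := (restr f (qmod red_rel)).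

Definition red_pi (m : M) : red_sort := qpi red_rel m.
Definition red_nabla (v : red_sort) : red_sort := qmap (@nabla _ _ _ _ M) v.
Definition red_act_fun (l : trunc R k) (v : red_sort) : red_sort :=
  cR (repr l) *: (v : qmod red_rel).

Lemma nabla_sum n (x : 'I_n -> M) : nabla (\sum_i x i) = \sum_i nabla (x i).
Proof.
have n0 : nabla (0 : M) = 0.
  by apply: (addIr (nabla 0)); rewrite -nablaD !add0r.
exact: (big_morph _ (@nablaD _ _ _ _ M) n0).
Qed.

Lemma red_rel_nabla v : mspan red_rel v -> mspan red_rel (nabla v).
Proof.
move=> [n [a [x [Sx ->]]]]; rewrite nabla_sum; apply: mspan_sum => i.
rewrite nablaM; apply: mspanD; apply: mspanZ; apply: sub_mspan; first exact: Sx.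
have [b [m [rb ->]]] := Sx i; rewrite nablaK.
by exists b, (nabla m).
Qed.

Lemma red_piP (v : red_sort) : exists m, v = red_pi m.
Proof. by exists (qrepr (v : qmod red_rel)); rewrite /red_pi qpiK. Qed.

Lemma red_piD : {morph red_pi : m n / m + n}.
Proof. exact: (raddfD (qpi red_rel)). Qed.

Lemma red_pi0 : red_pi 0 = 0.
Proof. exact: (raddf0 (qpi red_rel)). Qed.

Lemma red_pi_sum n (x : 'I_n -> M) : red_pi (\sum_i x i) = \sum_i red_pi (x i).
Proof. exact: (big_morph _ red_piD red_pi0). Qed.

Lemma red_piZ u m : u *: red_pi m = red_pi (f u *: m).
Proof. by rewrite [LHS]restrE [RHS](linearZZ (qpi red_rel)). Qed.

Lemma red_nablaE m : red_nabla (red_pi m) = red_pi (nabla m).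
Proof. exact: (qmapE (@nablaD _ _ _ _ M) red_rel_nabla). Qed.

Lemma red_act_funE a m : red_act_fun (tpi k a) (red_pi m) = red_pi (cR a *: m).
Proof.
rewrite /red_act_fun /red_pi -[LHS](linearZZ (qpi red_rel)).
apply/qpi_eq; rewrite -scalerBl -rmorphB; apply: sub_mspan.
by exists (repr (tpi k a) - a), m; split=> //; apply/tpi_eq; rewrite tpiK.
Qed.

Lemma red_fin : fin_gen red_sort.
Proof.
have [n [e eM]] := conn_fin M; have [p [w fw]] := f_fin k.
exists (p * n)%N, (fun i => let ij := enum_val (cast_ord (esym (mxvec_cast p n)) i) in
  red_pi (w ij.1 *: e ij.2)).
apply/seteqP; split=> // v _; have [m {v}->] := red_piP v.
have gen i j : (range (fun i => let ij := enum_val (cast_ord (esym (mxvec_cast p n)) i) in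
    red_pi (w ij.1 *: e ij.2))) (red_pi (w i *: e j)).
  by exists (mxvec_index i j) => //=; rewrite /mxvec_index cast_ordK enum_rankK.
have /mspan_rangeP[a ->] : mspan (range e) m by rewrite eM.
rewrite red_pi_sum; apply: mspan_sum => j.
have [x [q [b [t [rb ->]]]]] := fw (a j).
rewrite scalerDl red_piD.
have -> : red_pi ((\sum_i cR (b i) * t i) *: e j) = 0.
  rewrite -red_pi0; apply/qpi_eq; rewrite subr0 scaler_suml.
  apply: mspan_sum => i; rewrite -scalerA; apply: sub_mspan.
  by exists (b i), (t i *: e j).
rewrite addr0 scaler_suml red_pi_sum; apply: mspan_sum => i.
rewrite -scalerA -red_piZ.
by apply: mspanZ; apply: sub_mspan; exact: gen.
Qed.

Lemma red_nablaD : {morph red_nabla : u v / u + v}.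
Proof.
move=> u v; have [m ->] := red_piP u; have [n ->] := red_piP v.
by rewrite -red_piD !red_nablaE nablaD red_piD.
Qed.

Lemma red_nablaK a v : red_nabla (cC a *: v) = cC a *: red_nabla v.
Proof.
by have [m ->] := red_piP v; rewrite red_nablaE !red_piZ red_nablaE f_const nablaK.
Qed.

Lemma red_nablaM u v : red_nabla (u *: v) = dC u *: v + u *: red_nabla v.
Proof.
have [m ->] := red_piP v.
by rewrite red_nablaE !red_piZ red_nablaE nablaM red_piD f_der.
Qed.

Definition red_conn : conn cC dC := Conn red_fin red_nablaD red_nablaK red_nablaM.

Section Act.
Variable l : trunc R k.

Lemma red_act_linear : linear (red_act_fun l).
Proof.
move=> a u v; rewrite -(tpiK l); move: (repr l) => b.
have [m ->] := red_piP u; have [n ->] := red_piP v.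
rewrite red_piZ -red_piD !red_act_funE scalerDr red_piD red_piZ.
by rewrite !scalerA mulrC.
Qed.
HB.instance Definition _ := GRing.isLinear.Build AC red_sort red_sort *:%R
  (red_act_fun l) red_act_linear.

Lemma red_act_nabla v : red_act_fun l (red_nabla v) = red_nabla (red_act_fun l v).
Proof.
have [m ->] := red_piP v; rewrite red_nablaE -(tpiK l) !red_act_funE.
by rewrite red_nablaE nablaK.
Qed.

Definition red_act : chom red_conn red_conn :=
  @Chom _ _ _ _ red_conn red_conn (red_act_fun l) red_act_nabla.
End Act.

Lemma red_actE a m : red_act (tpi k a) (red_pi m) = red_pi (cR a *: m).
Proof. exact: red_act_funE. Qed.

Lemma red_act1 v : red_act 1 v = v.
Proof.
have [m ->] := red_piP v; rewrite -(rmorph1 (tpi k)).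
by rewrite red_actE rmorph1 scale1r.
Qed.

Lemma red_actM l l' v : red_act (l * l') v = red_act l (red_act l' v).
Proof.
rewrite -(tpiK l) -(tpiK l'); move: (repr l) (repr l') => a b.
have [m ->] := red_piP v; by rewrite -rmorphM !red_actE rmorphM scalerA.
Qed.

Lemma red_actD l l' v : red_act (l + l') v = red_act l v + red_act l' v.
Proof.
rewrite -(tpiK l) -(tpiK l'); move: (repr l) (repr l') => a b.
have [m ->] := red_piP v; by rewrite -rmorphD !red_actE rmorphD scalerDl red_piD.
Qed.

Lemma red_actZ c l v : red_act (c *: l) v = cC c *: red_act l v.
Proof.
rewrite -(tpiK l); move: (repr l) => a.
have [m ->] := red_piP v; rewrite tscaleE -rmorphM !red_actE.
by rewrite red_piZ f_const scalerA rmorphM.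
Qed.

(* M|_k with its action of R_k *)
Definition reduction : connAct cC dC (trunc R k) :=
  ConnAct red_act1 red_actM red_actD red_actZ.

End Reduction.

Section Reductions.
Variables (C : fieldType) (R : cnlAlg C).

Definition fps_incl : fps C -> fps R := map_fps (GRing.in_alg R).
Definition laurent_incl : laurent C -> laurent R := map_lau (GRing.in_alg R).
HB.instance Definition _ := GRing.RMorphism.on fps_incl.
HB.instance Definition _ := GRing.RMorphism.on laurent_incl.

Lemma fps_inclC a : fps_incl (fpsC a) = fpsC a%:A.
Proof. exact: map_fpsC. Qed.
Lemma fps_incl_theta u : fps_incl (ftheta u) = ftheta (fps_incl u).
Proof. exact: map_fps_theta. Qed.
Lemma laurent_inclC a : laurent_incl (laurC a) = laurC a%:A.
Proof. exact: map_laurC. Qed.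
Lemma laurent_incl_theta u : laurent_incl (ltheta u) = ltheta (laurent_incl u).
Proof. exact: map_lau_theta. Qed.

Lemma fps_sum n (F : 'I_n -> fps R) i : (\sum_j F j) i = \sum_j F j i.
Proof. exact: (big_morph (fun F : fps R => F i) (fun F G => fpsD F G i) (fps0 R i)). Qed.

Lemma fps_incl_fin k : exists n (e : 'I_n -> fps R), forall u,
  exists (x : 'I_n -> fps C) p (b : 'I_p -> R) (t : 'I_p -> fps R),
    (forall j, ideal_exp (cnl_max R) k.+1 (b j)) /\
    u = \sum_i fps_incl (x i) * e i + \sum_j fpsC (b j) * t j.
Proof.
have [n [e He]] := cnl_cofinite R k.+1; exists n, (fun i => fpsC (e i)) => u.
have [p [b Eb]] := cnl_noetherian R _ (ideal_exp_ideal (cnl_max R) k.+1).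
have /choice[x Hx] := fun i => He (u i).
have /choice[t Ht] : forall i, exists t : 'I_p -> R,
    u i - \sum_j (x i j)%:A * e j = \sum_j t j * b j.
  by move=> i; have := Hx i; rewrite Eb => /(@mspan_rangeP _ R^o).
exists (fun j => Fps (fun i => x i j)), p, b, (fun j => Fps (fun i => t i j)).
split=> [j|]; first by rewrite Eb; apply: (@sub_mspan _ R^o); exists j.
apply: fpsP => i; rewrite fpsD !fps_sum -[LHS](subrK (\sum_j (x i j)%:A * e j)).
rewrite Ht addrC; congr (_ + _); apply: eq_bigr => j _.
  by rewrite [_ * fpsC _]mulrC fpsCM mulrC.
by rewrite fpsCM mulrC.
Qed.

Lemma laurent_incl_fin k : exists n (e : 'I_n -> laurent R), forall u,
  exists (x : 'I_n -> laurent C) p (b : 'I_p -> R) (t : 'I_p -> laurent R),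
    (forall j, ideal_exp (cnl_max R) k.+1 (b j)) /\
    u = \sum_i laurent_incl (x i) * e i + \sum_j laurC (b j) * t j.
Proof.
have [n [e He]] := fps_incl_fin k; exists n, (fun i => fps_lau (e i)) => u.
have [N [F ->]] := lau_ex1 u; have [x [p [b [t [rb EF]]]]] := He F.
exists (fun i => lau N (x i)), p, b, (fun j => lau N (t j)); split=> //.
have -> : lau N F = lau N 1 * fps_lau F by rewrite lauM mul1r addn0.
rewrite EF rmorphD !rmorph_sum mulrDr !mulr_sumr; congr (_ + _).
  apply: eq_bigr => i _; rewrite rmorphM mulrA /laurent_incl map_lauE.
  by rewrite [lau N 1 * _]lauM mul1r addn0.
apply: eq_bigr => j _; rewrite rmorphM mulrCA; congr (_ * _).
by rewrite lauM mul1r addn0.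
Qed.

Definition red_log (M : MClog R) k : MClogAct (trunc R k) :=
  reduction fps_inclC fps_incl_theta fps_incl_fin M k.
Definition red_lau (M : MC R) k : MCAct (trunc R k) :=
  reduction laurent_inclC laurent_incl_theta laurent_incl_fin M k.

Definition red_log_pi (M : MClog R) k (m : M) : red_log M k :=
  red_pi fps_incl k m.
Definition red_lau_pi (M : MC R) k (m : M) : red_lau M k :=
  red_pi laurent_incl k m.

(* psi is the isomorphism gamma(E|_k) ~ M|_k obtained by reducing
   phi : gamma(E) ~ M; it is determined by its values on the 1 (x) [m] *)
Definition reduced_iso (E : MClog R) (M : MC R) (phi : chom (gamma E) M) k
    (psi : chom (gammaAct (red_log E k)) (red_lau M k)) :=
  is_iso psi /\ forall m : E,
    psi (tens (@fps_lau C) 1 (red_log_pi k m)) =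
    red_lau_pi k (phi (tens (@fps_lau R) 1 m)).

End Reductions.

Definition free_relative (K : fieldType) (L : comAlgType K) (N : MClogAct L) :=
  exists (V : lmodType L)
    (psi : {linear extscal (@fpsC K) (restr (GRing.in_alg L) V) -> N}),
    bijective psi /\ forall (l : L) (g : fps K) (v : V),
      psi (tens (@fpsC K) g (l *: v : restr (GRing.in_alg L) V)) =
      ca_act N l (psi (tens (@fpsC K) g (v : restr (GRing.in_alg L) V))).

Section Residue.
Variables (K : fieldType) (N : MClog K).

Definition xrel : set N := [set v | exists m, v = fpsX *: m].
Local Notation xfibre := (restr (@fpsC K) (qmod xrel)).

Definition residue (v : xfibre) : xfibre := qmap (@nabla _ _ _ _ N) v.

Lemma xrel_nabla v : mspan xrel v -> mspan xrel (nabla v).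
Proof.
move=> [n [a [x [Sx ->]]]].
have n0 : nabla (0 : N) = 0.
  by apply: (addIr (nabla 0)); rewrite -nablaD !add0r.
rewrite (big_morph _ (@nablaD _ _ _ _ N) n0); apply: mspan_sum => i.
rewrite nablaM; apply: mspanD; apply: mspanZ; first exact/sub_mspan/Sx.
have [m ->] := Sx i; rewrite nablaM fthetaX -scalerDr; apply: sub_mspan.
by exists (m + nabla m).
Qed.

Lemma residueE m : residue (qpi xrel m) = qpi xrel (nabla m).
Proof. exact: (qmapE (@nablaD _ _ _ _ N) xrel_nabla). Qed.

Lemma residue_linear : linear residue.
Proof.
move=> a u v; rewrite -(qpiK u) -(qpiK v) !restrE.
rewrite -qpiZ -qpiD [RHS](congr2 (fun x y => fpsC a *: (x : qmod xrel) + y)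
  (residueE _) (residueE _)) residueE nablaD nablaK qpiD qpiZ.
by [].
Qed.
HB.instance Definition _ :=
  GRing.isLinear.Build K xfibre xfibre *:%R residue residue_linear.

Definition is_exponent (a : K) := exists v : xfibre, v != 0 /\ residue v = a *: v.

End Residue.

(* Main.v *)
From HB Require Import structures.
Require Import Defs.
From mathcomp Require Import all_boot all_order all_algebra.
From mathcomp Require Import boolp classical_sets.
From mathcomp Require Import zify ring.

(** A logarithmic model of M amounts to a lattice: a finitely generated
    R[[x]]-submodule L of M which is stable under nabla and which spans M once
    x is inverted.  The proof moves a given lattice to one whose exponents lie
    in tau, and then shows that such a lattice has all the required properties.

    Moving the exponents.  By Cayley-Hamilton some monic G in R[X] satisfies
    G(nabla) L <= x L, and Hensel's lemma over the complete local ring R writes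
    G as a product of factors congruent to (X - l)^m modulo r (hensel_split).
    If G = G0 H, then L' = x L + G0(nabla) L is again a lattice, and
    G0(nabla - 1) H(nabla) maps L' into x L' (shear): the root l of G0 has moved
    to l + 1.  Together with the passage from L to x^-1 L, which lowers all
    roots by 1, this moves the roots independently of each other by arbitrary
    integers, hence into tau (tau_lattice).  Let E be the resulting lattice,
    with G(nabla) E <= x E and G congruent modulo r to a P in C[X] whose roots
    all lie in tau.

    Exponents.  As G = P modulo r, the operator Q(nabla) with Q = P^(k+1) maps
    N = E / r^(k+1) E into x N, so that the exponents of N are roots of P.

    Freeness.  Distinct elements of tau do not differ by an integer, so the
    translates P(X - j) are pairwise coprime.  This is used twice.  First, the
    x-torsion of N lies in x N (torsion_modX), which makes every C-basis of
    N / x N lift to a C[[x]]-basis of N.  Secondly, Bezout gives polynomials p_n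
    with p_n = 1 modulo Q and p_n = 0 modulo Q(X - 1) ... Q(X - n); the operators
    p_n(nabla) converge x-adically to a map sigma from N to N which kills x N,
    induces the identity on N / x N, and commutes with R_k as every polynomial
    in nabla does.  So sigma gives an R_k-linear section of N -> N / x N, and
    f (x) v |-> f sigma(v) is the wanted isomorphism (free_relative_of_poly).

    Compatibility.  A map j from a logarithmic object to Z, semilinear over the
    inclusion of power series into Laurent series, induces an isomorphism from
    gamma of its source to Z as soon as its kernel is killed by powers of x and
    each element of Z lies in its image up to a power of x (loc_hom_iso).  The
    inclusion of E into M and the reduced map from N to M / r^(k+1) M are both
    of this kind, and the second one commutes with R_k. *)

Set Implicit Arguments.
Unset Strict Implicit.
Unset Printing Implicit Defensive.

Import GRing.Theory.
Local Open Scope ring_scope.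
Local Open Scope classical_set_scope.

(** * Polynomials with coefficients in a power of the maximal ideal *)

Lemma coprimep_bezout (K : fieldType) (p q : {poly K}) : coprimep p q ->
  exists u v, u * p + v * q = 1.
Proof.
move=> /Bezout_coprimepP[[u v]] /= /eqpP[[a b] /= /andP[a0 b0] E].
exists (b^-1 * a *: u), (b^-1 * a *: v).
by rewrite -!scalerAl -scalerDr -scalerA E scalerA mulVf // scale1r.
Qed.

Section CoefIn.
Variables (C : fieldType) (R : cnlAlg C).
Local Notation r := (ideal_exp (cnl_max R)).
Implicit Types (p q : {poly R}) (k : nat).

Lemma max_exp1 (a : R) : cnl_max R a -> r 1 a.
Proof.
by move=> ra; apply: (@sub_mspan _ R^o); exists a, 1; split=> //; rewrite [RHS]mulr1.
Qed.

Lemma exp_mul1 k (a b : R) : r 1 a -> r k b -> r k.+1 (a * b).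
Proof.
move=> /(ideal_exp_sub (cnl_max_ideal R)) ra rb.
by apply: (@sub_mspan _ R^o); exists a, b.
Qed.

Lemma expW k (a : R) : r k.+1 a -> r k a.
Proof.
have [r0 rD rM] := ideal_exp_ideal (cnl_max R) k.
by apply: (@mspan_min _ R^o) => // _ [b [c [_ rc ->]]]; apply: rM.
Qed.

Lemma expW1 k (a : R) : r k.+1 a -> r 1 a.
Proof. by elim: k => // k IHk /expW. Qed.

Definition coef_in k q := forall i, r k q`_i.

Lemma coef_in0 k : coef_in k 0.
Proof. by move=> i; rewrite coef0; case: (ideal_exp_ideal (cnl_max R) k). Qed.

Lemma coef_inD k p q : coef_in k p -> coef_in k q -> coef_in k (p + q).
Proof.
move=> kp kq i; rewrite coefD.
by case: (ideal_exp_ideal (cnl_max R) k) => _ rD _; apply: rD.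
Qed.

Lemma coef_inM k p q : coef_in k q -> coef_in k (p * q).
Proof.
move=> kq i; rewrite coefM; apply: ideal_sum (ideal_exp_ideal _ _) _ => j.
by case: (ideal_exp_ideal (cnl_max R) k) => _ _ rM; apply: rM.
Qed.

Lemma coef_inN k q : coef_in k q -> coef_in k (- q).
Proof. by move=> kq; rewrite -mulN1r; apply: coef_inM. Qed.

Lemma coef_inB k p q : coef_in k p -> coef_in k q -> coef_in k (p - q).
Proof. by move=> kp kq; apply/coef_inD/coef_inN. Qed.

Lemma coef_in_mul1 k p q : coef_in 1 p -> coef_in k q -> coef_in k.+1 (p * q).
Proof.
move=> kp kq i; rewrite coefM; apply: ideal_sum (ideal_exp_ideal _ _) _ => j.
exact: exp_mul1.
Qed.

Lemma coef_inW k q : coef_in k.+1 q -> coef_in k q.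
Proof. by move=> kq i; apply: expW. Qed.

Lemma coef_inW1 k q : coef_in k.+1 q -> coef_in 1 q.
Proof. by move=> kq i; apply: (@expW1 k). Qed.

Lemma coef_in_exp k q : coef_in 1 q -> coef_in k.+1 (q ^+ k.+1).
Proof. by move=> kq; elim: k => // k IHk; rewrite exprS; apply: coef_in_mul1. Qed.

Lemma coef_in_mulB k p p' q q' :
  coef_in k (p - p') -> coef_in k (q - q') -> coef_in k (p * q - p' * q').
Proof.
move=> kp kq; have -> : p * q - p' * q' = p * (q - q') + q' * (p - p').
  by rewrite !mulrBr addrA (mulrC p q') subrK (mulrC q' p').
by apply: coef_inD; apply: coef_inM.
Qed.

Lemma coef_in_comp k p q : coef_in k q -> coef_in k (q \Po p).
Proof.
move=> kq; rewrite comp_polyE; elim/big_ind: _ => [|u v|i _].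
- exact: coef_in0.
- exact: coef_inD.
move=> j; rewrite coefZ mulrC.
by case: (ideal_exp_ideal (cnl_max R) k) => _ _ rM; apply: rM.
Qed.

(** Euclidean division by a monic polynomial involves no division of
    coefficients, hence stays inside the ideal. *)
Lemma coef_in_divmonic k p q : p \is monic -> coef_in k q ->
  exists h d, [/\ q = p * h + d, (size d < size p)%N, coef_in k h & coef_in k d].
Proof.
move=> mp; have [n] := ubnP (size q); elim: n q => // n IHn q ltqn kq.
case: (ltnP (size q) (size p)) => [ltqp|lepq].
  by exists 0, q; rewrite mulr0 add0r; split=> //; apply: coef_in0.
pose t := lead_coef q *: 'X^(size q - size p) : {poly R}.
have kt : coef_in k t.
  move=> i; rewrite coefZ mulrC.
  by case: (ideal_exp_ideal (cnl_max R) k) => _ _ rM; apply/rM/kq.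
have p0 : (0 < size p)%N by rewrite size_poly_gt0 monic_neq0.
have lt : (size (q - p * t)%R < size q)%N.
  rewrite [ltnRHS](_ : _ = (size q).-1.+1); last by lia.
  rewrite ltnS; apply/leq_sizeP => j lej.
  have Ept i : (p * t)`_i = lead_coef q *
      (if (i < size q - size p)%N then 0 else p`_(i - (size q - size p))%N).
    by rewrite /t -scalerAr coefZ coefMXn.
  rewrite coefB Ept; move: lej; rewrite leq_eqVlt => /predU1P[<-|lej].
    case: ltnP => [|_]; first by lia.
    have -> : ((size q).-1 - (size q - size p))%N = (size p).-1 by lia.
    by rewrite -[p`__]/(lead_coef p) (monicP mp) mulr1 subrr.
  have leqj : (size q <= j)%N by apply: leq_trans (leqSpred _) lej.
  rewrite (nth_default _ leqj).
  case: ltnP => _; first by rewrite mulr0 subr0.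
  have aux a b c : (a <= b -> b <= c -> a <= c - (b - a))%N by lia.
  by rewrite (nth_default _ (aux _ _ _ lepq leqj)) mulr0 subr0.
have [||h [d [E ltd kh kd]]] := IHn (q - p * t).
- exact: leq_trans lt _.
- by apply: coef_inB => //; apply: coef_inM.
exists (h + t), d; split=> //; last exact: coef_inD.
by rewrite mulrDr addrAC -E subrK.
Qed.

(** By uniqueness of the division by p, the quotient q of p q is the one
    produced by coef_in_divmonic. *)
Lemma coef_in_monicl k p q : p \is monic -> coef_in k (p * q) -> coef_in k q.
Proof.
move=> mp kpq; have [h [d [E ltd kh kd]]] := coef_in_divmonic mp kpq.
suff -> : q = h by [].
apply/eqP; rewrite -subr_eq0; apply: contraTT ltd => qh.
have -> : d = p * (q - h) by rewrite mulrBr E addrC addKr.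
have aux a b : (0 < b -> a <= (a + b).-1)%N by lia.
by rewrite size_monicM // -leqNgt aux // size_poly_gt0.
Qed.

End CoefIn.

(** * Hensel's lemma *)

Section Hensel.
Variables (C : fieldType) (R : cnlAlg C).
Local Notation r := (ideal_exp (cnl_max R)).
Implicit Types (p q A D : {poly R}) (k : nat).

Definition const_poly : {poly C} -> {poly R} := map_poly (in_alg R).
HB.instance Definition _ := GRing.RMorphism.on const_poly.

Lemma const_poly_monic (q : {poly C}) : q \is monic -> const_poly q \is monic.
Proof. by rewrite map_monic. Qed.

Lemma size_const_poly (q : {poly C}) : size (const_poly q) = size q.
Proof. exact: size_map_poly. Qed.

(** Separatedness of R, in the indexing of the approximations used below. *)
Lemma exp_sep (a : R) : (forall k, r k.+1 a) -> a = 0.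
Proof. by move=> ra; apply: (cnl_complete R).1 => k; apply: expW. Qed.

(** The bound on the sizes is what lets the coefficientwise limit be a
    polynomial. *)
Lemma poly_limit (u : nat -> {poly R}) n : (forall k, (size (u k) <= n)%N) ->
  (forall k, coef_in k (u k.+1 - u k)) ->
  exists p, (size p <= n)%N /\ forall k, coef_in k (p - u k).
Proof.
move=> un ku.
have /choice[a Ha] i : exists a, forall k, r k (a - (u k)`_i).
  by apply: (cnl_complete R).2 => k; rewrite -coefB; apply: ku.
exists (\poly_(i < n) a i); split=> [|k i]; first exact: size_poly.
rewrite coefB coef_poly; case: ltnP => [_|le_ni]; first exact: Ha.
rewrite nth_default ?subr0; last exact: leq_trans (un k) le_ni.
by case: (ideal_exp_ideal (cnl_max R) k).
Qed.

Section Lift.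
Variables (G : {poly R}) (Q1 Q2 U V : {poly C}).
Hypotheses (mG : G \is monic) (mQ1 : Q1 \is monic) (UV : U * Q1 + V * Q2 = 1).
Hypothesis GQ : coef_in 1 (G - const_poly (Q1 * Q2)).

Definition approx_factor k (AD : {poly R} * {poly R}) :=
  [/\ AD.1 \is monic, size AD.1 = size Q1, coef_in 1 (AD.1 - const_poly Q1),
      coef_in 1 (AD.2 - const_poly Q2) & coef_in k.+1 (G - AD.1 * AD.2)].

(** Newton step: with G = A D + Z, the correction d of A is V Z reduced modulo A,
    and D is corrected so that the error becomes
    - (U A + V D - 1) Z - d s, a product of an element of r and one of r^(k+1).
    Only A has controlled size, so only the sequence of the A has a limit. *)
Lemma approx_factor_step k AD : approx_factor k AD ->
  exists AD', approx_factor k.+1 AD' /\ coef_in k.+1 (AD'.1 - AD.1).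
Proof.
case: AD => A D [/= mA sA AQ DQ kG].
have [h [d [E ltd kh kd]]] := coef_in_divmonic mA (coef_inM (const_poly V) kG).
set Z := G - A * D in kG E.
pose s := const_poly U * Z + D * h.
have ks : coef_in k.+1 s by apply: coef_inD; apply: coef_inM.
exists (A + d, D + s); rewrite /= [A + d - A]addrAC subrr add0r; split=> //.
have sAd : size (A + d) = size Q1 by rewrite size_polyDl.
have mAd : A + d \is monic.
  by apply/monicP; rewrite lead_coefDl //; apply/monicP.
split=> //=.
- by rewrite addrAC; apply: coef_inD => //; apply: coef_inW1 kd.
- by rewrite addrAC; apply: coef_inD => //; apply: coef_inW1 ks.
have UV' : coef_in 1 (const_poly U * A + const_poly V * D - 1).
  rewrite -(rmorph1 const_poly) -UV rmorphD !rmorphM opprD addrACA.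
  by apply: coef_inD; rewrite -mulrBr; apply: coef_inM.
have -> : G - (A + d) * (D + s) =
    - ((const_poly U * A + const_poly V * D - 1) * Z) - d * s.
  have -> : d = const_poly V * Z - A * h by rewrite E addrC addKr.
  by rewrite /s /Z; ring.
apply: coef_inB; first by apply/coef_inN/coef_in_mul1.
by apply: coef_in_mul1 => //; apply: coef_inW1 kd.
Qed.

(** The second factor is not obtained as a limit: once the limit A of the first
    factors is known, the remainder of G modulo A lies in every r^(k+1), so
    that A divides G, and the quotient is congruent to Q2 since Q1 is monic. *)
Lemma hensel_aux : exists G1 G2, [/\ G = G1 * G2, G1 \is monic,
  size G1 = size Q1, coef_in 1 (G1 - const_poly Q1) & coef_in 1 (G2 - const_poly Q2)].
Proof.
have AD0 : approx_factor 0 (const_poly Q1, const_poly Q2).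
  split=> /=; rewrite ?subrr -?rmorphM //; first exact: const_poly_monic.
  - exact: size_const_poly.
  - exact: coef_in0.
  - exact: coef_in0.
have /choice[f Hf] : forall x : nat * ({poly R} * {poly R}), exists y,
    approx_factor x.1 x.2 -> approx_factor x.1.+1 y /\ coef_in x.1.+1 (y.1 - x.2.1).
  move=> [k AD]; case: (pselect (approx_factor k AD)) => [/approx_factor_step[y Hy]|nH].
    by exists y.
  by exists AD.
pose u := fix u k := if k is k'.+1 then f (k', u k')
  else (const_poly Q1, const_poly Q2).
have Hu k : approx_factor k (u k) by elim: k => // k IHk; case: (Hf (k, u k) IHk).
have du k : coef_in k.+1 ((u k.+1).1 - (u k).1) by case: (Hf (k, u k) (Hu k)).
have [||A [sA HA]] := @poly_limit (fun k => (u k).1) (size Q1).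
- by move=> k /=; case: (Hu k) => _ -> _ _ _.
- by move=> k; apply/coef_inW/du.
have kA k : coef_in k.+1 (A - (u k).1).
  have -> : A - (u k).1 = (A - (u k.+1).1) + ((u k.+1).1 - (u k).1).
    by rewrite addrA subrK.
  by apply: coef_inD.
have Q1_gt0 : (0 < size Q1)%N by rewrite size_poly_gt0 monic_neq0.
(* the limit A keeps the size and the leading coefficient of Q1 *)
have A1 : A`_(size Q1).-1 = 1.
  apply/eqP; rewrite -subr_eq0; apply/eqP/exp_sep => k.
  have := kA k (size Q1).-1; rewrite coefB.
  by case: (Hu k) => /monicP + su _ _ _; rewrite lead_coefE su => ->.
have sA' : size A = size Q1.
  apply/eqP; rewrite eqn_leq sA /=.
  have [lt|] := leqP (size A) (size Q1).-1.
    by have := A1; rewrite nth_default // => /esym/eqP; rewrite oner_eq0.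
  have aux a b : (0 < b -> b.-1 < a -> b <= a)%N by lia.
  exact: aux Q1_gt0.
have mA : A \is monic by apply/monicP; rewrite lead_coefE sA'.
(* G is a multiple of A modulo every r^(k+1) *)
have kG k : exists D, coef_in k.+1 (G - A * D).
  exists (u k).2; case: (Hu k) => _ _ _ _ Gk.
  have -> : G - A * (u k).2 = (G - (u k).1 * (u k).2) - (u k).2 * (A - (u k).1).
    by ring.
  by apply: coef_inB => //; apply: coef_inM.
have EG : G = A * Pdiv.Ring.rdivp G A.
  rewrite mulrC {1}(Pdiv.RingMonic.rdivp_eq mA G) -[RHS]addr0; congr (_ + _).
  apply/polyP => i; rewrite coef0; apply: exp_sep => k; move: i.
  have [D GD] := kG k; have [h [d [E ltd kh kd]]] := coef_in_divmonic mA GD.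
  suff -> : Pdiv.Ring.rmodp G A = d by [].
  have -> : G = (D + h) * A + d.
    by rewrite -(subrK (A * D) G) E; ring.
  rewrite Pdiv.RingMonic.rmodpD // Pdiv.RingMonic.rmodp_mull // add0r.
  by rewrite Pdiv.Ring.rmodp_small.
have AQ : coef_in 1 (A - const_poly Q1).
  have -> : A - const_poly Q1 = (A - (u 0%N).1) by [].
  exact: kA.
exists A, (Pdiv.Ring.rdivp G A); split=> //.
apply: (@coef_in_monicl _ _ 1 (const_poly Q1)); first exact: const_poly_monic.
have -> : const_poly Q1 * (Pdiv.Ring.rdivp G A - const_poly Q2) =
   (A * Pdiv.Ring.rdivp G A - const_poly (Q1 * Q2)) - Pdiv.Ring.rdivp G A * (A - const_poly Q1).
  by rewrite rmorphM; ring.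
by rewrite -EG; apply: coef_inB => //; apply: coef_inM.
Qed.

End Lift.

Lemma hensel G (Q1 Q2 : {poly C}) : G \is monic -> Q1 \is monic -> coprimep Q1 Q2 ->
  coef_in 1 (G - const_poly (Q1 * Q2)) ->
  exists G1 G2, [/\ G = G1 * G2, G1 \is monic, size G1 = size Q1,
    coef_in 1 (G1 - const_poly Q1) & coef_in 1 (G2 - const_poly Q2)].
Proof.
by move=> mG mQ1 /coprimep_bezout[U [V UV]]; apply: hensel_aux UV.
Qed.

Lemma residue_poly G : G \is monic ->
  exists g : {poly C}, g \is monic /\ coef_in 1 (G - const_poly g).
Proof.
move=> mG; have /choice[c Hc] : forall a : R, exists c : C, cnl_max R (a - c%:A).
  by move=> a; have [c [rc _]] := cnl_residue R a; exists c.
have G_gt0 : (0 < size G)%N by rewrite size_poly_gt0 monic_neq0.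
have aux a b : (0 < a -> b != a.-1 -> (b < a.-1) = (b < a))%N by lia.
pose t := \poly_(i < (size G).-1) (c G`_i).
pose g := 'X^((size G).-1) + t.
have ltg : (size t < size ('X^((size G).-1) : {poly C}))%N.
  by rewrite size_polyXn ltnS size_poly.
exists g; split.
  by apply/monicP; rewrite lead_coefDl // lead_coefXn.
move=> i; rewrite coefB coef_map coefD coefXn coef_poly.
have [r0 _ _] := ideal_exp_ideal (cnl_max R) 1.
have [->|ni] := eqVneq i (size G).-1.
  by rewrite ltnn addr0 /= -lead_coefE (monicP mG) scale1r subrr.
rewrite add0r aux //; case: ltnP => [_|leGi]; first exact: max_exp1.
by rewrite nth_default //= scale0r subrr.
Qed.

End Hensel.

(** Splitting off one root of the residual polynomial at a time: the power of
    X - c in it is coprime to the remaining factor. *)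
Lemma hensel_split (C : closedFieldType) (R : cnlAlg C) (G : {poly R}) : G \is monic ->
  exists s : seq ({poly R} * C), G = \prod_(x <- s) x.1 /\
    forall x, x \in s -> exists m, coef_in 1 (x.1 - const_poly R (('X - x.2%:P) ^+ m)).
Proof.
have [n] := ubnP (size G); elim: n G => // n IHn G ltG mG.
have [g [mg Gg]] := residue_poly mG.
have [sg|sg] := eqVneq (size g) 1%N.
  have g1 : g = 1.
    by move/eqP: sg mg => /size_poly1P[c c0 ->]; rewrite monicE lead_coefC => /eqP ->.
  exists [:: (G, 0)]; split; first by rewrite big_seq1.
  by move=> x; rewrite inE => /eqP ->; exists 0%N; rewrite expr0 /= -g1.
have /closed_rootP[c gc] := sg.
have [m [q]] := multiplicity_XsubC g c; rewrite monic_neq0 //= => qc Eg.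
have mX : ('X - c%:P) ^+ m \is monic by rewrite monic_exp // monicXsubC.
have mgt0 : (0 < m)%N.
  case: m Eg mX => // Eg _.
  by move: gc qc; rewrite Eg expr0 mulr1 => ->.
have [||||G1 [G2 [EG mG1 sG1 G1g G2q]]] := @hensel _ R G (('X - c%:P) ^+ m) q.
- by [].
- by [].
- by apply: coprimep_expl; rewrite coprimep_sym coprimep_XsubC.
- by rewrite mulrC -Eg.
have mG2 : G2 \is monic by move: mG; rewrite EG monicMl.
have [||s [Es Hs]] := IHn G2.
- rewrite EG size_monicM ?monic_neq0 // sG1 size_exp_XsubC in ltG.
  have aux a b : (0 < a -> (a.+1 + b).-1 < n.+1 -> b < n)%N by lia.
  exact: aux mgt0 ltG.
- by [].
exists ((G1, c) :: s); rewrite big_cons -Es; split=> // x.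
by rewrite inE => /predU1P[->|/Hs//]; exists m.
Qed.

(** * Power series *)

Section FpsFacts.
Variable A : comNzRingType.
Implicit Types (f g : fps A) (n : nat).

Lemma fpsXnM n f : fpsX ^+ n * f = fshift n f.
Proof.
have E1 g : fpsX * g = fshift 1 g.
  have -> : fpsX = fshift 1 (1 : fps A).
    by apply: fpsP => -[|[|i]].
  by rewrite fshiftM mul1r.
elim: n => [|n IHn] in f *; last by rewrite exprS -mulrA IHn E1 fshift_shift.
by rewrite mul1r; apply: fpsP => i /=; rewrite subn0.
Qed.

Lemma fps_divX n f : (forall i, (i < n)%N -> f i = 0) ->
  f = fpsX ^+ n * Fps (fun i => f (i + n)%N).
Proof.
move=> f0; rewrite fpsXnM; apply: fpsP => i /=.
by case: ltnP => [/f0//|le_ni]; rewrite subnK.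
Qed.

Lemma fpsXnM_coef n f i : (i < n)%N -> (fpsX ^+ n * f) i = 0.
Proof. by rewrite fpsXnM /= => ->. Qed.

Lemma fps_decomp f : exists g, f = fpsC (f 0%N) + fpsX * g.
Proof.
exists (Fps (fun i => f i.+1)); apply: fpsP => -[|i]; rewrite fpsD -[fpsX]expr1 fpsXnM /=.
  by rewrite addr0.
by rewrite add0r subn1.
Qed.

Definition fps_ev0 f : A := f 0%N.

Lemma fps_ev0_zmod : zmod_morphism fps_ev0.
Proof. by []. Qed.
Lemma fps_ev0_monoid : monoid_morphism fps_ev0.
Proof. by split=> // f g; rewrite /fps_ev0 fpsM big_ord1. Qed.
HB.instance Definition _ := GRing.isZmodMorphism.Build (fps A) A fps_ev0 fps_ev0_zmod.
HB.instance Definition _ := GRing.isMonoidMorphism.Build (fps A) A fps_ev0 fps_ev0_monoid.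

(** The inverse is the geometric series of h = 1 - f; its n-th coefficient can be
    read off the partial sum S (n + 1), as h is divisible by x. *)
Lemma fps_unit f : f 0%N = 1 -> exists g, g * f = 1.
Proof.
move=> f0; pose h := 1 - f.
have [h1 Eh] : exists h1, h = fpsX * h1.
  have [h1 Eh] := fps_decomp h; exists h1; rewrite {1}Eh.
  by rewrite [h 0%N](_ : _ = 0) ?rmorph0 ?add0r //= f0 subrr.
pose S n := \sum_(i < n) h ^+ i.
have SE n i : (i < n)%N -> S n i = S i.+1 i.
  move=> lt_in; rewrite -(subnKC lt_in).
  elim: (n - i.+1)%N => [|k IHk]; first by rewrite addn0.
  have -> : S (i.+1 + k.+1)%N = S (i.+1 + k)%N + h ^+ (i.+1 + k).
    by rewrite addnS /S big_ord_recr.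
  rewrite fpsD IHk -[RHS]addr0; congr (_ + _).
  by rewrite Eh exprMn fpsXnM_coef // leq_addr.
exists (Fps (fun n => S n.+1 n)); apply: fpsP => n.
have -> : (Fps (fun n => S n.+1 n) * f) n = (S n.+1 * f) n.
  rewrite !fpsM; apply: eq_bigr => i _ /=.
  by rewrite [in RHS]SE.
have -> : S n.+1 * f = 1 - h ^+ n.+1.
  have -> : f = 1 - h by rewrite /h subKr.
  have := subrX1 h n.+1; rewrite /S => E.
  by rewrite mulrC -[RHS]opprB E; ring.
by rewrite fpsD fpsN Eh exprMn fpsXnM_coef // subr0.
Qed.

End FpsFacts.

(** * Polynomials in a connection *)

Section PolyAction.
Variables (K A : comNzRingType) (c : {rmorphism K -> A}) (d : A -> A) (E : conn c d).
Implicit Types (p q : {poly K}) (m : E).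
Local Notation nab := (@nabla _ _ _ _ E).

Definition pact q m : E := \sum_(i < size q) c q`_i *: iter i nab m.

Lemma nabla0 : nab 0 = 0.
Proof. by apply: (addIr (nab 0)); rewrite -nablaD !add0r. Qed.

Lemma nablaB m n : nab (m - n) = nab m - nab n.
Proof. by apply: (addIr (nab n)); rewrite -nablaD !subrK. Qed.

Lemma iter_nablaD i : {morph iter i nab : m n / m + n}.
Proof. by move=> m n; elim: i => //= i ->; rewrite nablaD. Qed.

Lemma pactE n q m : (size q <= n)%N -> pact q m = \sum_(i < n) c q`_i *: iter i nab m.
Proof.
move=> leqn; rewrite /pact -!(big_mkord xpredT (fun i => c q`_i *: iter i nab m)).
rewrite [RHS](@big_cat_nat _ _ _ (size q)) //= -[LHS]addr0; congr (_ + _).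
rewrite big_nat big1 // => i /andP[lei _].
by rewrite nth_default // rmorph0 scale0r.
Qed.

Lemma pactDl p q m : pact (p + q) m = pact p m + pact q m.
Proof.
pose n := maxn (size p) (size q).
rewrite !(@pactE n) ?leq_maxl ?leq_maxr ?size_polyD // -big_split.
by apply: eq_bigr => i _; rewrite coefD rmorphD scalerDl.
Qed.

Lemma pactC a m : pact a%:P m = c a *: m.
Proof. by rewrite (@pactE 1) ?size_polyC ?leq_b1 // big_ord1 coefC. Qed.

Lemma pact1 m : pact 1 m = m.
Proof. by rewrite pactC rmorph1 scale1r. Qed.

Lemma pact0 m : pact 0 m = 0.
Proof. by rewrite pactC rmorph0 scale0r. Qed.

Lemma pactMX q m : pact (q * 'X) m = pact q (nab m).
Proof.
rewrite (@pactE (size q).+1) ; last first.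
  by rewrite (leq_trans (size_polyMleq _ _)) // size_polyX addn2.
rewrite big_ord_recl coefMX /= rmorph0 scale0r add0r.
by apply: eq_bigr => i _; rewrite coefMX /= -iterSr.
Qed.

Lemma pactDr q : {morph pact q : m n / m + n}.
Proof.
move=> m n; rewrite /pact -big_split; apply: eq_bigr => i _.
by rewrite iter_nablaD scalerDr.
Qed.

Lemma pact0r q : pact q 0 = 0.
Proof. by apply: (addIr (pact q 0)); rewrite -pactDr !add0r. Qed.

Lemma pact_sum q n (x : 'I_n -> E) : pact q (\sum_i x i) = \sum_i pact q (x i).
Proof. exact: (big_morph _ (@pactDr q) (pact0r q)). Qed.

Lemma pactNl q m : pact (- q) m = - pact q m.
Proof. by apply: (addIr (pact q m)); rewrite -pactDl !addNr pact0. Qed.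

Lemma pactBl p q m : pact (p - q) m = pact p m - pact q m.
Proof. by rewrite pactDl pactNl. Qed.

Lemma pactK q a m : pact q (c a *: m) = c a *: pact q m.
Proof.
elim/poly_ind: q m => [|q b IHq] m; first by rewrite !pact0 scaler0.
by rewrite !pactDl !pactMX nablaK IHq !pactC scalerDr !scalerA mulrC.
Qed.

Lemma pactM p q m : pact (p * q) m = pact p (pact q m).
Proof.
elim/poly_ind: q m => [|q b IHq] m; first by rewrite mulr0 !pact0 pact0r.
rewrite mulrDr mulrA !pactDl !pactMX IHq pactC pactDr pactK; congr (_ + _).
by rewrite mulrC mul_polyC -[_ *: p]mul_polyC; elim/poly_ind: p {IHq} m => [|p a IHp] m;
  rewrite ?mulr0 ?pact0 ?scaler0 // mulrDr mulrA !pactDl !pactMX IHp -polyCM !pactC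
    rmorphM scalerDr scalerA.
Qed.

Lemma pact_nabla q m : pact q (nab m) = nab (pact q m).
Proof.
rewrite -pactMX mulrC pactM /pact.
rewrite -/(pact 'X _) -['X]mul1r pactMX pact1 //.
Qed.

(** x is meant to be the variable, an eigenvector of the derivation d, so that
    nabla x = x (nabla + 1). *)
Lemma pact_shift x q m : d x = x -> pact q (x *: m) = x *: pact (q \Po ('X + 1)) m.
Proof.
move=> dx; elim/poly_ind: q m => [|q b IHq] m; first by rewrite comp_poly0 !pact0 scaler0.
rewrite pactDl pactMX pactC nablaM dx -scalerDr IHq comp_polyD comp_polyM comp_polyX.
rewrite comp_polyC pactDl mulrDr mulr1 pactDl pactMX pactC addrC.
by rewrite pactDr [_ + pact _ (nab m)]addrC !scalerDr !scalerA [c b * x]mulrC addrC.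
Qed.

Lemma pact_shiftn x n q m : d x = x ->
  pact q (x ^+ n *: m) = x ^+ n *: pact (q \Po ('X + n%:R%:P)) m.
Proof.
move=> dx; elim: n q m => [|n IHn] q m.
  by rewrite !scale1r addr0 comp_polyXr.
rewrite exprS -!scalerA pact_shift // IHn -comp_polyA; congr (_ *: (_ *: pact (_ \Po _) _)).
by rewrite comp_polyD comp_polyX comp_polyC -addrA -polyCD mulrSr.
Qed.

End PolyAction.

(** Naturality of q(nabla), for maps between connections over different base
    rings: it applies to inclusions of lattices, to reductions modulo powers of
    r, and to the action of R_k. *)
Lemma pact_morph (K A : comNzRingType) (c : {rmorphism K -> A}) (d : A -> A)
    (E : conn c d) (K' A' : comNzRingType) (c' : {rmorphism K' -> A'}) (d' : A' -> A')
    (E' : conn c' d') (g : E -> E') (q : {poly K}) (q' : {poly K'}) m :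
  {morph g : u v / u + v} -> (forall u, g (nabla u) = nabla (g u)) ->
  (forall i u, g (c q`_i *: u) = c' q'`_i *: g u) ->
  g (pact q m) = pact q' (g m).
Proof.
move=> gD gnab gq; have g0 : g 0 = 0 by apply: (addIr (g 0)); rewrite -gD !add0r.
rewrite !(@pactE _ _ _ _ _ (maxn (size q) (size q'))) ?leq_maxl ?leq_maxr //.
rewrite (big_morph _ gD g0); apply: eq_bigr => i _; rewrite gq; congr (_ *: _).
by elim: (i : nat) => //= j <-.
Qed.

(** * Finitely generated modules over formal power series over a field *)

Section FpsModule.
Variables (K : fieldType) (M : lmodType (fps K)).
Hypothesis M_fin : fin_gen M.

Definition spans_modX d (v : 'I_d -> M) := forall m, exists (c : 'I_d -> K) m',
  m = \sum_i fpsC (c i) *: v i + fpsX *: m'.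

Definition free_modX d (v : 'I_d -> M) := forall (c : 'I_d -> K) m',
  \sum_i fpsC (c i) *: v i = fpsX *: m' -> forall i, c i = 0.

(** A generating family modulo x of minimal length: a relation with c i
    invertible would allow to drop v i. *)
Lemma basis_modX : exists d (v : 'I_d -> M), spans_modX v /\ free_modX v.
Proof.
pose P d := `[< exists v : 'I_d -> M, spans_modX v >].
have exP : exists d, P d.
  have [d [v vM]] := M_fin; exists d; apply/asboolP; exists v => m.
  have /mspan_rangeP[a ->] : mspan (range v) m by rewrite vM.
  have /choice[b Hb] := fun i => fps_decomp (a i).
  exists (fun i => a i 0%N), (\sum_i b i *: v i).
  rewrite scaler_sumr -big_split; apply: eq_bigr => i _.
  by rewrite {1}Hb scalerDl scalerA.
case: (ex_minnP exP) => d /asboolP[v sv] min; exists d, v; split=> // c m' E i.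
apply/eqP; apply: contraT => ci; case: d => [|d] in v sv min c E i ci *; first by case: i ci.
suff /asboolP/min : exists v : 'I_d -> M, spans_modX v by rewrite ltnn.
exists (fun j => v (lift i j)) => m; have [b [m1 ->]] := sv m.
have Ev : v i = \sum_j fpsC (- ((c i)^-1 * c (lift i j))) *: v (lift i j)
    + fpsX *: (fpsC (c i)^-1 *: m').
  have -> : fpsX *: (fpsC (c i)^-1 *: m') = fpsC (c i)^-1 *: (fpsX *: m').
    by rewrite !scalerA mulrC.
  rewrite -E (bigD1_ord i) //= scalerDr scalerA -rmorphM mulVf // rmorph1 scale1r.
  rewrite scaler_sumr addrCA -big_split big1 ?addr0 // => j _.
  by rewrite /= scalerA -rmorphM rmorphN scaleNr addNr.
exists (fun j => b (lift i j) - b i * ((c i)^-1 * c (lift i j))),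
  (m1 + fpsC (b i) *: (fpsC (c i)^-1 *: m')).
rewrite (bigD1_ord i) //= {1}Ev !scalerDr.
have -> : fpsC (b i) *: (fpsX *: (fpsC (c i)^-1 *: m')) =
   fpsX *: (fpsC (b i) *: (fpsC (c i)^-1 *: m')) by rewrite !scalerA [fpsC _ * fpsX]mulrC.
rewrite [X in X + fpsX *: m1]addrAC -[LHS]addrA; congr (_ + _); last exact: addrC.
rewrite scaler_sumr -big_split; apply: eq_bigr => j _.
by rewrite /= scalerA -rmorphM -scalerDl -rmorphD mulrN addrC.
Qed.

(** Nakayama's lemma.  If e generates M, the hypothesis expresses (1 - x A) e in
    terms of w for some matrix A, and det (1 - x A), having constant term 1, is
    invertible. *)
Lemma nakayama_modX d (w : 'I_d -> M) : spans_modX w ->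
  forall m, exists f : 'I_d -> fps K, m = \sum_i f i *: w i.
Proof.
move=> sw m; apply/mspan_rangeP; move: m; have [p [e eM]] := M_fin.
suff He : forall i, mspan (range w) (e i).
  move=> m; have /mspan_rangeP[a ->] : mspan (range e) m by rewrite eM.
  by apply: mspan_sum => i; apply: mspanZ.
have /choice[c Hc] := fun i => sw (e i).
have /choice[n Hn] := Hc.
have /choice[a Ha] : forall i, exists a : 'I_p -> fps K, n i = \sum_j a j *: e j.
  by move=> i; apply/mspan_rangeP; rewrite eM.
pose B : 'M[fps K]_p := 1%:M - fpsX *: \matrix_(i, j) a i j.
move=> i; have HB j : mspan (range w) (\sum_l B j l *: e l).
  have -> : \sum_l B j l *: e l = e j - fpsX *: n j.
    rewrite Ha scaler_sumr (bigD1 j) //= [in RHS](bigD1 j) //= opprD addrA -sumrN.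
    rewrite !mxE eqxx scalerBl scale1r scalerA; congr (_ + _).
    apply: eq_bigr => l /negbTE lj.
    by rewrite !mxE eq_sym lj add0r scaleNr scalerA.
  rewrite {1}Hn addrK; apply: mspan_sum => l.
  by apply/mspanZ/sub_mspan; exists l.
have det1 : fps_ev0 (\det B) = 1.
  rewrite -det_map_mx (_ : map_mx _ B = 1%:M) ?det1 //.
  apply/matrixP => j l; rewrite !mxE rmorphB rmorph_nat rmorphM /= /fps_ev0 /=.
  by rewrite mul0r subr0.
have [g Eg] := fps_unit det1.
have -> : e i = g *: \sum_j (\adj B) i j *: \sum_l B j l *: e l.
  under eq_bigr do rewrite scaler_sumr.
  rewrite exchange_big /=.
  have E l : \sum_j \adj B i j *: (B j l *: e l) = (\adj B *m B) i l *: e l.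
    by rewrite mxE scaler_suml; apply: eq_bigr => j _; rewrite scalerA.
  under eq_bigr do rewrite E mul_adj_mx mxE.
  rewrite (bigD1 i) //= eqxx mulr1n big1 ?addr0 ?scalerA ?Eg ?scale1r // => l /negbTE li.
  by rewrite eq_sym li mulr0n scale0r.
by apply/mspanZ/mspan_sum => j; apply/mspanZ.
Qed.

(** A relation f can be divided by the highest power of x dividing all its
    coefficients; the torsion hypothesis then makes the sum for the quotient lie
    in x M, although some constant term of the quotient is non-zero. *)
Lemma free_of_modX d (w : 'I_d -> M) :
  (forall a (m : M), fpsX ^+ a *: m = 0 -> exists m', m = fpsX *: m') -> free_modX w ->
  forall f : 'I_d -> fps K, \sum_i f i *: w i = 0 -> forall i, f i = 0.
Proof.
move=> tors fw f f0 i; apply: contrapT => fi.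
have exn : exists n, [exists i, f i n != 0].
  apply: contrapT => nex; apply: fi; apply: fpsP => n; rewrite fps0.
  by apply/eqP; apply: contrapT => /negP fin; apply: nex; exists n; apply/existsP; exists i.
case: (ex_minnP exn) => n /existsP[j fj] min.
have Ef l : f l = fpsX ^+ n * Fps (fun i => f l (i + n)%N).
  apply: fps_divX => k lt_kn; apply/eqP; apply: contraLR lt_kn => flk.
  by rewrite -leqNgt; apply: min; apply/existsP; exists l.
have [|m Em] := tors n (\sum_l Fps (fun i => f l (i + n)%N) *: w l).
  rewrite scaler_sumr -[RHS]f0; apply: eq_bigr => l _.
  by rewrite scalerA -Ef.
have /choice[g Hg] := fun l => fps_decomp (Fps (fun i => f l (i + n)%N)).
suff /fw/(_ j)/= : \sum_l fpsC ((Fps (fun i => f l (i + n)%N)) 0%N) *: w l =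
    fpsX *: (m - \sum_l g l *: w l).
  by move=> E; move: fj; rewrite (_ : f j n = 0) ?eqxx //; exact: E.
rewrite scalerBr -Em scaler_sumr -sumrB; apply: eq_bigr => l _.
by rewrite [in RHS]Hg scalerDl scalerA addrK.
Qed.

(** M is a quotient of a power of the complete ring of power series: lift the
    successive differences to coefficients on a generating family and sum them. *)
Lemma fps_module_complete (w : nat -> M) :
  (forall n, exists m, w n.+1 - w n = fpsX ^+ n *: m) ->
  exists l, forall n, exists m, l - w n = fpsX ^+ n *: m.
Proof.
move=> /choice[m Hm]; have [p [e eM]] := M_fin.
have /choice[a Ha] n : exists a : 'I_p -> fps K, m n = \sum_j a j *: e j.
  by apply/mspan_rangeP; rewrite eM.
have Ew n : w n = w 0%N + \sum_i (\sum_(k < n) fpsX ^+ k * a k i) *: e i.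
  elim: n => [|n IHn].
    by rewrite big1 ?addr0 // => i _; rewrite big_ord0 scale0r.
  rewrite -(subrK (w n) (w n.+1)) Hm IHn addrCA; congr (_ + _).
  rewrite Ha scaler_sumr -big_split; apply: eq_bigr => i _ /=.
  by rewrite big_ord_recr scalerDl scalerA addrC.
pose h i := Fps (fun j => (\sum_(k < j.+1) fpsX ^+ k * a k i) j).
exists (w 0%N + \sum_i h i *: e i) => n.
have Eh i : h i - \sum_(k < n) fpsX ^+ k * a k i =
    fpsX ^+ n * Fps (fun j => (h i - \sum_(k < n) fpsX ^+ k * a k i) (j + n)%N).
  apply: fps_divX => j lt_jn; rewrite fpsD fpsN /= -(subnKC lt_jn).
  elim: (n - j.+1)%N => [|k IHk]; first by rewrite addn0 subrr.
  rewrite addnS [in X in _ - X]big_ord_recr fpsD opprD addrA IHk.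
  by rewrite fpsXnM_coef ?subr0 /= ?leq_addr.
exists (\sum_i Fps (fun j => (h i - \sum_(k < n) fpsX ^+ k * a k i) (j + n)%N) *: e i).
rewrite (Ew n) opprD addrACA subrr add0r -sumrB scaler_sumr.
by apply: eq_bigr => i _; rewrite scalerA -Eh scalerBl.
Qed.

Lemma fps_module_separated d (w : 'I_d -> M) : spans_modX w ->
  (forall f : 'I_d -> fps K, \sum_i f i *: w i = 0 -> forall i, f i = 0) ->
  forall m : M, (forall n, exists m', m = fpsX ^+ n *: m') -> m = 0.
Proof.
move=> sw fw m Hm; have [f Ef] := nakayama_modX sw m.
rewrite Ef big1 // => i _; suff -> : f i = 0 by rewrite scale0r.
apply: fpsP => n; rewrite fps0; have [m' Em] := Hm n.+1.
have [g Eg] := nakayama_modX sw m'.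
have /fw/(_ i)/eqP : \sum_i (f i - fpsX ^+ n.+1 * g i) *: w i = 0.
  under eq_bigr do rewrite scalerBl -scalerA.
  by rewrite sumrB -scaler_sumr -Eg -Ef -Em subrr.
by rewrite subr_eq0 => /eqP ->; rewrite fpsXnM_coef.
Qed.

End FpsModule.

(** * Translates of polynomials, and freeness over C[[x]] *)

(** q(X - j): on x^j N, the operator q(nabla - j) acts as q(nabla) does on N. *)
Definition translate (K : comNzRingType) (j : nat) (q : {poly K}) : {poly K} :=
  q \Po ('X - j%:R%:P).

Section Translate.
Variable K : comNzRingType.
Implicit Types (q : {poly K}).

Lemma translate0 q : translate 0 q = q.
Proof. by rewrite /translate subr0 comp_polyXr. Qed.

Lemma translateK j q : translate j q \Po ('X + j%:R%:P) = q.
Proof.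
by rewrite /translate -comp_polyA comp_polyB comp_polyX comp_polyC addrK comp_polyXr.
Qed.

Lemma translateS j q : translate j.+1 q \Po ('X + 1) = translate j q.
Proof.
rewrite /translate -comp_polyA comp_polyB comp_polyX comp_polyC -addrA; congr (_ \Po (_ + _)).
by rewrite -natr1 polyCD opprD addrCA subrr addr0.
Qed.

Lemma comp_prod n (F : 'I_n -> {poly K}) p : (\prod_i F i) \Po p = \prod_i (F i \Po p).
Proof.
by apply: (big_morph (fun q => q \Po p)) => [q q'|]; rewrite ?comp_polyM ?comp_polyC.
Qed.

(** The operator q(nabla - j) maps x^j N to x^(j+1) N, so that the translates
    climb the x-adic filtration one step each. *)
Lemma pact_translates (N : MClog K) q : (forall m : N, exists m', pact q m = fpsX *: m') ->
  forall n (m : N), exists m', pact (\prod_(j < n) translate j q) m = fpsX ^+ n *: m'.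
Proof.
move=> qX; elim=> [|n IHn] m; first by exists m; rewrite big_ord0 pact1 scale1r.
have [m1 E1] := IHn m; have [m2 E2] := qX m1; exists m2.
rewrite big_ord_recr /= mulrC pactM E1 pact_shiftn ?fthetaX // translateK E2.
by rewrite scalerA exprSr.
Qed.

End Translate.

(** An alias, as N already is a module over the power series. *)
Definition act_mod (K : comNzRingType) (L : comAlgType K) (N : MClogAct L) : Type := N.

Section ActMod.
Variables (K : comNzRingType) (L : comAlgType K) (N : MClogAct L).
HB.instance Definition _ := GRing.Zmodule.on (act_mod N).

Definition act_scale (l : L) (m : act_mod N) : act_mod N := ca_act N l m.

Lemma act_scaleA a b m : act_scale a (act_scale b m) = act_scale (a * b) m.
Proof. by rewrite /act_scale ca_actM. Qed.
Lemma act_scale1 : left_id 1 act_scale.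
Proof. by move=> m; rewrite /act_scale ca_act1. Qed.
Lemma act_scaleDr : right_distributive act_scale +%R.
Proof. by move=> a m n; rewrite /act_scale raddfD. Qed.
Lemma act_scaleDl m : {morph act_scale^~ m : a b / a + b}.
Proof. by move=> a b; rewrite /act_scale ca_actD. Qed.
HB.instance Definition _ := GRing.Zmodule_isLmodule.Build L (act_mod N)
  act_scaleA act_scale1 act_scaleDr act_scaleDl.

(** x N is an L-submodule, so that N / x N is an L-module: it is the V of the
    definition of freeness relative to L. *)
Definition act_xset : set (act_mod N) := [set v | exists m : N, v = fpsX *: m].

Lemma mspan_act_xset v : mspan act_xset v -> act_xset v.
Proof.
move: v; apply: mspan_min => //.
- by exists 0; rewrite scaler0.
- by move=> _ _ [m ->] [n ->]; exists (m + n); rewrite scalerDr.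
by move=> a _ [m ->]; exists (ca_act N a m); rewrite -linearZ.
Qed.
End ActMod.

Section FreeRelative.
Variables (K : fieldType) (L : comAlgType K) (N : MClogAct L) (Q : {poly K}).
Hypothesis QX : forall m : N, exists m', pact Q m = fpsX *: m'.
Hypothesis Qcop : forall j, coprimep Q (translate j.+1 Q).
Hypothesis tors : forall a (m : N), fpsX ^+ a *: m = 0 -> exists m', m = fpsX *: m'.

Let H n := \prod_(j < n) translate j.+1 Q.

Let bezout n : exists uv : {poly K} * {poly K}, uv.1 * Q + uv.2 * H n = 1.
Proof.
suff /coprimep_bezout[u [v E]] : coprimep Q (H n) by exists (u, v).
rewrite /H; elim/big_ind: _ => [|p q|j _] //; first exact: coprimep1.
by rewrite coprimepMr => -> ->.
Qed.

Let u n := (projT1 (cid (bezout n))).1.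
Let v n := (projT1 (cid (bezout n))).2.
Let uv n : u n * Q + v n * H n = 1. Proof. by rewrite /u /v; case: cid. Qed.
Let p n := v n * H n.

(** H n (nabla) maps x N to x^(n+1) N *)
Let HX n (m : N) : exists m', pact (H n) (fpsX *: m) = fpsX ^+ n.+1 *: m'.
Proof.
rewrite pact_shift ?fthetaX // /H comp_prod; under eq_bigr do rewrite translateS.
have [m' ->] := pact_translates QX n m; exists m'.
by rewrite scalerA exprS.
Qed.

Let pX n (m : N) : exists m', pact (p n) (fpsX *: m) = fpsX ^+ n.+1 *: m'.
Proof.
rewrite /p pactM; have [m' ->] := HX n m.
by rewrite pact_shiftn ?fthetaX //; eexists.
Qed.

Let p1 n (m : N) : exists m', pact (p n) m = m + fpsX *: m'.
Proof.
have -> : p n = 1 - u n * Q by rewrite -(uv n) addrC addKr.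
rewrite pactBl pact1 pactM; have [m' ->] := QX m; rewrite pact_shift ?fthetaX //.
by eexists; rewrite -scalerN.
Qed.

(** p (n + 1) - p n is divisible by both Q and H n, and Q(nabla) N lies in x N,
   which H n (nabla) sends into x^(n+1) N *)
Let dp n (m : N) : exists m', pact (p n.+1) m - pact (p n) m = fpsX ^+ n.+1 *: m'.
Proof.
have HS : H n.+1 = H n * translate n.+1 Q by rewrite /H big_ord_recr.
have E : p n.+1 - p n =
    (v n.+1 * translate n.+1 Q * u n - v n * u n.+1) * (H n * Q).
  transitivity (p n.+1 * (u n * Q + p n) - p n * (u n.+1 * Q + p n.+1)).
    by rewrite !uv !mulr1.
  by rewrite /p HS; ring.
rewrite -pactBl E pactM pactM; have [m1 ->] := QX m; have [m2 ->] := HX n m1.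
by rewrite pact_shiftn ?fthetaX //; eexists.
Qed.

Let lim_rel (m l : N) := forall n, exists m', l - pact (p n) m = fpsX ^+ n *: m'.

Let lim_ex m : exists l, lim_rel m l.
Proof.
apply: (fps_module_complete (conn_fin N)) => n; have [m' ->] := dp n m.
by exists (fpsX *: m'); rewrite scalerA exprSr.
Qed.

(** the limit of the operators p n (nabla); linearity and equivariance follow
   from the uniqueness of limits *)
Let sigma (m : N) : N := projT1 (cid (lim_ex m)).
Let sigmaP m : lim_rel m (sigma m). Proof. by rewrite /sigma; case: cid. Qed.

Let lim_uniq m l l' : lim_rel m l -> lim_rel m l' -> l = l'.
Proof.
have [d [w [sw fw]]] := basis_modX (conn_fin N).
move=> Hl Hl'; apply/eqP; rewrite -subr_eq0; apply/eqP.
apply: (fps_module_separated (conn_fin N) sw (free_of_modX tors fw)) => n.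
have [a Ea] := Hl n; have [b Eb] := Hl' n; exists (a - b).
by rewrite scalerBr -Ea -Eb opprB addrA subrK.
Qed.

Let sigmaD : {morph sigma : m n / m + n}.
Proof.
move=> m n; apply: lim_uniq (sigmaP _) _ => i.
have [a Ea] := sigmaP m i; have [b Eb] := sigmaP n i; exists (a + b).
by rewrite scalerDr -Ea -Eb pactDr opprD addrACA.
Qed.

Let sigma_act l m : sigma (ca_act N l m) = ca_act N l (sigma m).
Proof.
apply: lim_uniq (sigmaP _) _ => i; have [a Ea] := sigmaP m i.
exists (ca_act N l a); rewrite -linearZ -Ea linearB; congr (_ - _).
apply/esym/pact_morph => [|n|j n]; [exact: raddfD | exact: chom_nabla | exact: linearZ].
Qed.

Let sigmaX m : sigma (fpsX *: m) = 0.
Proof.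
apply: lim_uniq (sigmaP _) _ => i; have [a ->] := pX i m.
by exists (- (fpsX *: a)); rewrite sub0r scalerN scalerA exprSr.
Qed.

Let sigma1 m : exists m', sigma m = m + fpsX *: m'.
Proof.
have [a Ea] := sigmaP m 1%N; have [b Eb] := p1 1 m.
by exists (b + a); rewrite -(subrK (pact (p 1) m) (sigma m)) Ea Eb expr1 addrC -addrA -scalerDr.
Qed.

Let V := qmod (@act_xset _ _ N).
Local Notation Vr := (restr (GRing.in_alg L) V).
Let pi (m : N) : V := qpi (@act_xset _ _ N) m.
Let sbar (y : V) : N := sigma (qrepr y).

Let sbar_pi m : sbar (pi m) = sigma m.
Proof.
rewrite /sbar /pi; have /qpi_eq/mspan_act_xset[m' E] := qpiK (qpi (@act_xset _ _ N) m).
rewrite -[qrepr _](subrK (m : act_mod N)) sigmaD E.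
by rewrite sigmaX add0r.
Qed.

Let piP (y : V) : exists m, y = pi m.
Proof. by have [m ->] := qpiP y; exists m. Qed.

Let piD m n : pi (m + n) = pi m + pi n.
Proof. exact: (raddfD (qpi (@act_xset _ _ N))). Qed.

Let piZ l m : pi (ca_act N l m) = l *: pi m.
Proof. exact: (linearZZ (qpi (@act_xset _ _ N)) l (m : act_mod N)). Qed.

Let piX m : pi (fpsX *: m) = 0.
Proof.
rewrite /pi -(raddf0 (qpi (@act_xset _ _ N))); apply/qpi_eq; rewrite subr0.
by apply: sub_mspan; exists m.
Qed.

Let piC c m : (pi (fpsC c *: m) : Vr) = c *: (pi m : Vr).
Proof. by rewrite restrE -piZ ca_actZ ca_act1. Qed.

Let sbarD : {morph sbar : y z / y + z}.
Proof.
move=> y z; have [m ->] := piP y; have [n ->] := piP z.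
by rewrite -piD !sbar_pi sigmaD.
Qed.

Let sbarZ l y : sbar (l *: y) = ca_act N l (sbar y).
Proof. by have [m ->] := piP y; rewrite -piZ !sbar_pi sigma_act. Qed.

(** f (x) v |-> f sigma(v). *)
Definition section_extension : extscal (@fpsC K) Vr -> N :=
  extlift (@fpsC K) (fun (b : fps K) (y : Vr) => b *: sbar y).

Let bal b a (y : Vr) : b *: sbar (a *: y : Vr) = (b * fpsC a) *: sbar y.
Proof. by rewrite restrE sbarZ ca_actZ ca_act1 scalerA. Qed.

Let psiE b y : section_extension (tens (@fpsC K) b y) = b *: sbar y.
Proof.
by rewrite /section_extension extliftE // => [m c c'|c m m']; rewrite ?scalerDl // sbarD scalerDr.
Qed.

Let psiD : {morph section_extension : y z / y + z}.
Proof.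
by apply: extliftD => // [m c c'|c m m']; rewrite ?scalerDl // sbarD scalerDr.
Qed.

Let psi_linear : linear section_extension.
Proof.
have psi0 : section_extension 0 = 0 by apply: (addIr (section_extension 0)); rewrite -psiD !add0r.
move=> a y z; rewrite psiD; congr (_ + _).
elim/tens_ind: y => [|y1 y2 IH1 IH2|b y]; first by rewrite scaler0 psi0 scaler0.
  by rewrite scalerDr !psiD IH1 IH2 scalerDr.
by rewrite tensZl !psiE scalerA.
Qed.

HB.instance Definition _ :=
  GRing.isLinear.Build (fps K) (extscal (@fpsC K) Vr) N *:%R section_extension psi_linear.
Let psi : {linear extscal (@fpsC K) Vr -> N} := section_extension.

(** A basis w of N modulo x stays one after replacing each w i by sigma (w i),
    which is congruent to it; so the sigma (w i) form a basis of N over the power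
    series, while the classes of the w i generate V. *)
Lemma free_relative_of_poly : free_relative N.
Proof.
exists V, psi; split; last first.
  move=> l g y; rewrite [LHS]psiE [X in _ = ca_act N l X]psiE sbarZ.
  by rewrite linearZ.
have [d [w [sw fw]]] := basis_modX (conn_fin N).
pose w' i := sigma (w i).
have /choice[t Ht] : forall i, exists m, w' i = w i + fpsX *: m by move=> i; apply: sigma1.
have sumw' (c : 'I_d -> K) : \sum_i fpsC (c i) *: w' i =
    \sum_i fpsC (c i) *: w i + fpsX *: \sum_i fpsC (c i) *: t i.
  rewrite scaler_sumr -big_split; apply: eq_bigr => i _.
  by rewrite Ht scalerDr !scalerA mulrC.
have sw' : spans_modX w'.
  move=> m; have [c [m' ->]] := sw m; exists c, (m' - \sum_i fpsC (c i) *: t i).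
  by rewrite sumw' scalerBr addrA addrAC addrK.
have fw' : free_modX w'.
  move=> c m' E; apply: (fw c (m' - \sum_i fpsC (c i) *: t i)).
  by rewrite scalerBr -E sumw' addrK.
have surj m : exists y, section_extension y = m.
  have [f ->] := nakayama_modX (conn_fin N) sw' m.
  exists (\sum_i tens (@fpsC K) (f i) (pi (w i) : Vr)).
  by rewrite [LHS](raddf_sum psi); apply: eq_bigr => i _; rewrite [LHS]psiE sbar_pi.
have gen y : exists f : 'I_d -> fps K, y = \sum_i tens (@fpsC K) (f i) (pi (w i) : Vr).
  elim/tens_ind: y => [|_ _ [f ->] [g ->]|b y].
  - exists (fun=> 0); rewrite big1 // => i _.
    by rewrite tensE scale0r.
  - exists (fun i => f i + g i); rewrite -big_split; apply: eq_bigr => i _.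
    by rewrite tensDl.
  have [m ->] := piP y; have [c [m' ->]] := sw m.
  rewrite piD piX addr0; exists (fun i => b * fpsC (c i)).
  have pi_sum : pi (\sum_i fpsC (c i) *: w i) = \sum_i pi (fpsC (c i) *: w i).
    exact: (raddf_sum (qpi (@act_xset _ _ N))).
  have tens_sum (z : 'I_d -> Vr) :
      tens (@fpsC K) b (\sum_i z i) = \sum_i tens (@fpsC K) b (z i).
    have t0 : tens (@fpsC K) b (0 : Vr) = 0.
      by apply: (addIr (tens (@fpsC K) b (0 : Vr))); rewrite -tensDr !add0r.
    exact: (big_morph _ (tensDr _ _) t0).
  rewrite pi_sum tens_sum; apply: eq_bigr => i _.
  by rewrite piC tensZr.
have inj : injective section_extension.
  suff ker y : section_extension y = 0 -> y = 0.
    move=> y z E; apply/eqP; rewrite -subr_eq0; apply/eqP/ker.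
    by rewrite [LHS](raddfB psi) /= E subrr.
  have [f ->] := gen y; rewrite [LHS](raddf_sum psi) => E.
  rewrite big1 // => i _; suff -> : f i = 0 by rewrite tensE scale0r.
  apply: (free_of_modX tors fw'); rewrite -[RHS]E; apply: eq_bigr => j _.
  by rewrite [RHS]psiE sbar_pi.
have /choice[g Hg] := surj.
by exists g => [y|m]; [apply: inj; apply: Hg | apply: Hg].
Qed.

End FreeRelative.

(** * Reductions of a logarithmic object annihilated modulo x by G(nabla) *)

(** On an eigenvector of the residue for the eigenvalue a, Q(nabla) acts modulo x
    as multiplication by Q(a), and also as 0. *)
Lemma exponent_root (K : fieldType) (N : MClog K) (Q : {poly K}) (a : K) :
  (forall m : N, exists m', pact Q m = fpsX *: m') -> is_exponent N a -> root Q a.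
Proof.
move=> QX [y [y0 Ey]]; have [n En] := qpiP (y : qmod (@xrel _ N)).
have Sn : mspan (@xrel _ N) (nabla n - fpsC a *: n).
  by apply/qpi_eq; rewrite -residueE -En [LHS]Ey En restrE [RHS]qpiZ.
have Sq q : forall m, mspan (@xrel _ N) (nabla m - fpsC a *: m) ->
    mspan (@xrel _ N) (pact q m - fpsC q.[a] *: m).
  elim/poly_ind: q => [|q b IHq] m Sm.
    by rewrite pact0 horner0 rmorph0 scale0r subrr; apply: mspan0.
  rewrite pactDl pactMX pactC hornerMXaddC rmorphD rmorphM.
  rewrite scalerDl opprD addrACA subrr addr0.
  have Snm : mspan (@xrel _ N) (nabla (nabla m) - fpsC a *: nabla m).
    by rewrite -nablaK -nablaB; apply: xrel_nabla.
  rewrite -(subrK (fpsC q.[a] *: nabla m) (pact q _)) -addrA; apply: mspanD; first exact: IHq.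
  by rewrite -scalerA -scalerBr; apply: mspanZ.
apply: contraNT y0 => Qa; apply/eqP; rewrite En -[0 in RHS](qpi0 (@xrel _ N)).
apply/qpi_eq; rewrite subr0.
have [m' Em'] := QX n; have := Sq Q n Sn; rewrite Em' => SQ.
have -> : n = fpsC (Q.[a])^-1 *: (fpsC Q.[a] *: n).
  by rewrite scalerA -rmorphM mulVf // rmorph1 scale1r.
apply: mspanZ; rewrite -[X in mspan _ X]opprK; apply: mspanN.
rewrite -[X in mspan _ X](addKr (fpsX *: m')); apply: mspanD => //.
by apply/mspanN/sub_mspan; exists m'.
Qed.

Lemma translate_translate (K : comNzRingType) i j (q : {poly K}) :
  translate i (translate j q) = translate (i + j) q.
Proof.
rewrite /translate -comp_polyA comp_polyB comp_polyX comp_polyC.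
by rewrite natrD polyCD opprD addrA.
Qed.

Lemma fps_inclX (C : fieldType) (R : cnlAlg C) : fps_incl R fpsX = fpsX.
Proof. by apply: fpsP => i; exact: (rmorph_nat (GRing.in_alg R)). Qed.

Section Reduced.
Variables (C : fieldType) (R : cnlAlg C) (E : MClog R) (G : {poly R}) (P : {poly C}).
Hypothesis Xinj : forall m : E, fpsX *: m = 0 -> m = 0.
Hypothesis GX : forall m : E, exists m', pact G m = fpsX *: m'.
Hypothesis GP : coef_in 1 (G - const_poly R P).
Hypothesis Pcop : forall j, coprimep P (translate j.+1 P).
Local Notation r := (ideal_exp (cnl_max R)).

(** r^j E.  Constant coefficients suffice, as power series can be absorbed into
    the vectors. *)
Definition ideal_mul j : set E := [set m | exists n (b : 'I_n -> R) (y : 'I_n -> E),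
  (forall i, r j (b i)) /\ m = \sum_i fpsC (b i) *: y i].

Lemma ideal_mul_gen j a m : r j a -> ideal_mul j (fpsC a *: m).
Proof. by move=> ra; exists 1%N, (fun=> a), (fun=> m); rewrite big_ord1. Qed.

Lemma ideal_mul0 j : ideal_mul j 0.
Proof. by exists 0%N, (fun=> 0), (fun=> 0); split=> [[]//|]; rewrite big_ord0. Qed.

Lemma ideal_mulD j m n : ideal_mul j m -> ideal_mul j n -> ideal_mul j (m + n).
Proof.
move=> [p [a [x [Sx ->]]]] [q [b [y [Sy ->]]]].
exists (p + q)%N, (fun i => match fintype.split i with inl j => a j | inr j => b j end),
  (fun i => match fintype.split i with inl j => x j | inr j => y j end); split.
  by move=> i; case: (fintype.split i).
rewrite big_split_ord; congr (_ + _); apply: eq_bigr => i _ /=.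
  by rewrite (unsplitK (inl i)).
by rewrite (unsplitK (inr i)).
Qed.

Lemma ideal_mul_sum j n (y : 'I_n -> E) : (forall i, ideal_mul j (y i)) ->
  ideal_mul j (\sum_i y i).
Proof. by move=> Hy; elim/big_ind: _ => //; [apply: ideal_mul0 | apply: ideal_mulD]. Qed.

Lemma ideal_mulZ j f m : ideal_mul j m -> ideal_mul j (f *: m).
Proof.
move=> [n [b [y [rb ->]]]]; exists n, b, (fun i => f *: y i); split=> //.
by rewrite scaler_sumr; apply: eq_bigr => i _; rewrite !scalerA mulrC.
Qed.

Lemma ideal_mul_pact j q m : ideal_mul j m -> ideal_mul j (pact q m).
Proof.
move=> [n [b [y [rb ->]]]]; exists n, b, (fun i => pact q (y i)); split=> //.
by rewrite pact_sum; apply: eq_bigr => i _; rewrite pactK.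
Qed.

Lemma coef_in_pact j q m : coef_in j q -> ideal_mul j (pact q m).
Proof. by move=> jq; apply: ideal_mul_sum => i; apply: ideal_mul_gen. Qed.

Lemma ideal_mul_mul1 j b m : r j b -> ideal_mul 1 m -> ideal_mul j.+1 (fpsC b *: m).
Proof.
move=> rb [n [c [y [rc ->]]]]; exists n, (fun i => c i * b), y; split.
  by move=> i; apply: exp_mul1.
by rewrite scaler_sumr; apply: eq_bigr => i _; rewrite scalerA -rmorphM mulrC.
Qed.

Lemma mspan_red_rel k m : mspan (@red_rel _ _ _ _ _ E k) m <-> ideal_mul k.+1 m.
Proof.
split; last first.
  move=> [n [b [y [rb ->]]]]; apply: mspan_sum => i; apply: sub_mspan.
  by exists (b i), (y i).
move: m; apply: mspan_min; first exact: ideal_mul0.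
- exact: ideal_mulD.
- by move=> f m; apply: ideal_mulZ.
by move=> _ [b [m [rb ->]]]; apply: ideal_mul_gen.
Qed.

(** P(nabla) maps E into x E + r E, as G(nabla) E lies in x E and G - P has
    coefficients in r; being R-linear, it then maps r^j E into x E + r^(j+1) E. *)
Lemma pact_residual_exp j (m : E) : exists m' w,
  ideal_mul j w /\ pact (const_poly R (P ^+ j)) m = fpsX *: m' + w.
Proof.
elim: j => [|j [m1 [w [[n [b [y [rb Ew]]]] Em]]]].
  exists 0, m; split; last by rewrite rmorph1 pact1 scaler0 add0r.
  by rewrite -[m]scale1r -(rmorph1 (@fpsC R)); apply: ideal_mul_gen.
have /choice[z Hz] i : exists z, pact G (y i) = fpsX *: z by apply: GX.
have PE u : pact (const_poly R P) u = pact G u - pact (G - const_poly R P) u.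
  by rewrite pactBl subKr.
exists (pact (const_poly R P \Po ('X + 1)) m1 + \sum_i fpsC (b i) *: z i),
  (- \sum_i fpsC (b i) *: pact (G - const_poly R P) (y i)); split.
  rewrite -sumrN; apply: ideal_mul_sum => i; rewrite -scalerN; apply: ideal_mul_mul1 => //.
  by rewrite -scaleN1r; apply/ideal_mulZ/coef_in_pact.
rewrite exprS rmorphM pactM Em pactDr pact_shift ?fthetaX // scalerDr -addrA; congr (_ + _).
rewrite Ew pact_sum scaler_sumr -sumrB; apply: eq_bigr => i _.
by rewrite pactK PE Hz scalerBr !scalerA mulrC.
Qed.

Let translate_cong j : coef_in 1 (translate j G - const_poly R (translate j P)).
Proof.
have -> : const_poly R (translate j P) = translate j (const_poly R P).
  rewrite /const_poly /translate map_comp_poly rmorphB /= map_polyX map_polyC.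
  by congr (_ \Po (_ - _%:P)); exact: (rmorph_nat (GRing.in_alg R)).
by rewrite /translate -comp_polyB; apply: coef_in_comp.
Qed.

Let translate_cop i j : (i < j)%N -> coprimep (translate i P) (translate j P).
Proof.
move=> lt_ij; have -> : j = (i + (j - i.+1).+1)%N by rewrite addnS -addSn subnKC.
by rewrite -translate_translate; apply: coprimep_comp_poly.
Qed.

(** Let K be the product of the G(X - j) for j < a, and H = G(X - a).  They are
    coprime modulo r, so S (U K + V H) = 1 - rho^(k+1) with rho^(k+1) in r^(k+1).
    Since K(nabla) maps E into x^a E, it maps x^a m, an element of r^(k+1) E, into
    x^a r^(k+1) E; and H(nabla) x^a m = x^a G(nabla) m lies in x^(a+1) E.  Hence
    x^a m lies in x^a (x E + r^(k+1) E), and x^a can be cancelled. *)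
Lemma torsion_modX k a (m : E) : ideal_mul k.+1 (fpsX ^+ a *: m) ->
  exists m' w, ideal_mul k.+1 w /\ m = fpsX *: m' + w.
Proof.
move=> [n [b [y [rb Em]]]].
have Xa_inj (u v : E) : fpsX ^+ a *: u = fpsX ^+ a *: v -> u = v.
  elim: a {m n b y rb Em} u v => [|a IHa] u v; first by rewrite !scale1r.
  rewrite exprS -!scalerA => /eqP; rewrite -subr_eq0 -scalerBr => /eqP/Xinj/eqP.
  by rewrite subr_eq0 => /eqP/IHa.
pose K (q : {poly R}) := \prod_(j < a) translate j q.
have cop : coprimep (\prod_(j < a) translate j P) (translate a P).
  elim/big_ind: _ => [|p q|j _]; first exact: coprime1p.
    by rewrite coprimepMl => ->.
  exact: translate_cop.
have [U [V EUV]] := coprimep_bezout cop.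
pose rho := 1 - (const_poly R U * K G + const_poly R V * translate a G).
have rho1 : coef_in 1 rho.
  have KK : coef_in 1 (K G - const_poly R (\prod_(j < a) translate j P)).
    rewrite /K rmorph_prod; elim/big_rec2: _ => [|j p q _ IH].
      by rewrite subrr; apply: coef_in0.
    by apply: coef_in_mulB => //; apply: translate_cong.
  rewrite /rho -(rmorph1 (const_poly R)) -EUV rmorphD !rmorphM opprD addrACA -!mulrBr.
  by apply: coef_inD; apply: coef_inM; rewrite -opprB; apply: coef_inN.
pose S := \sum_(i < k.+1) rho ^+ i.
have E1 : 1 = rho ^+ k.+1 + (S * const_poly R U * K G + S * const_poly R V * translate a G).
  rewrite -[LHS](subrK (rho ^+ k.+1)) addrC; congr (_ + _).
  rewrite -opprB subrX1 -/S -mulNr opprB -!mulrA -mulrDr mulrC; congr (_ * _).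
  by rewrite /rho subKr.
have /choice[z Hz] i := pact_translates GX a (y i).
have [m1 Em1] := GX m.
exists (pact ((S * const_poly R V) \Po ('X + a.+1%:R%:P)) m1),
  (pact (rho ^+ k.+1 \Po ('X + a%:R%:P)) m +
   pact ((S * const_poly R U) \Po ('X + a%:R%:P)) (\sum_i fpsC (b i) *: z i)); split.
  apply: ideal_mulD; first by apply/coef_in_pact/coef_in_comp/coef_in_exp.
  by apply: ideal_mul_pact; exists n, b, z.
apply: Xa_inj; rewrite -[LHS]pact1 E1 !pactDl (pactM _ (K G)) (pactM _ (translate a G)).
rewrite [in X in _ + (X + _)]Em (pact_sum (K G)).
have -> : \sum_i pact (K G) (fpsC (b i) *: y i) = fpsX ^+ a *: \sum_i fpsC (b i) *: z i.
  rewrite scaler_sumr; apply: eq_bigr => i _.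
  by rewrite pactK Hz !scalerA mulrC.
rewrite (pact_shiftn a (translate a G)) ?fthetaX // translateK Em1 scalerA -exprSr.
rewrite !pact_shiftn ?fthetaX // [fpsX ^+ _.+1]exprSr -scalerA -!scalerDr; congr (_ *: _).
by rewrite addrA addrC.
Qed.

Section Level.
Variable k : nat.
Local Notation N := (red_log E k).
Local Notation pi := (red_log_pi k).
Let Q := P ^+ k.+1.

Let piXn a (m : E) : pi (fpsX ^+ a *: m) = fpsX ^+ a *: (pi m : N).
Proof. by rewrite [RHS]red_piZ rmorphXn /= fps_inclX. Qed.

Let pi_pact q (m : E) : pi (pact (const_poly R q) m) = pact q (pi m : N).
Proof.
apply: (@pact_morph _ _ _ _ E _ _ _ _ N) => [|u|i u].
- exact: red_piD.
- by rewrite [RHS]red_nablaE.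
  by rewrite [RHS]red_piZ /= fps_inclC coef_map.
Qed.

Let pi_eq0 (m : E) : pi m = 0 <-> ideal_mul k.+1 m.
Proof.
rewrite -mspan_red_rel -[X in mspan _ X]subr0; split.
  by move=> E0; apply/qpi_eq; rewrite [LHS]E0 qpi0.
by move=> /qpi_eq E0; rewrite [LHS]E0 qpi0.
Qed.

Let piP (n : N) : exists m, n = pi m.
Proof. exact: red_piP. Qed.

Lemma red_log_polyX (n : N) : exists n' : N, pact Q n = fpsX *: n'.
Proof.
have [m ->] := piP n; have [m' [w [Iw Em]]] := pact_residual_exp k.+1 m.
exists (pi m'); rewrite -pi_pact Em [LHS]red_piD [X in _ + X](_ : _ = 0); last exact/pi_eq0.
by rewrite addr0; have := piXn 1 m'; rewrite !expr1.
Qed.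

Lemma red_log_exponent c : is_exponent N c -> root P c.
Proof.
by move=> /(exponent_root red_log_polyX); rewrite /root horner_exp expf_eq0.
Qed.

Lemma red_log_free : free_relative N.
Proof.
apply: (free_relative_of_poly red_log_polyX) => [j|a n].
  by rewrite /translate rmorphXn coprimep_expl ?coprimep_expr //; exact: Pcop.
have [m ->] := piP n; rewrite -piXn => /pi_eq0/torsion_modX[m' [w [Iw Em]]].
exists (pi m'); rewrite Em [LHS]red_piD [X in _ + X](_ : _ = 0); last exact/pi_eq0.
by rewrite addr0; have := piXn 1 m'; rewrite !expr1.
Qed.

End Level.
End Reduced.

(** * Lattices and shearing *)

Section Lattice.
Variables (K : comNzRingType) (M : MC K).
Local Notation X := (fps_lau fpsX : laurent K).
(* lau N F stands for x^-N F *)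
Local Notation Xi := (lau 1 1 : laurent K).

Lemma mulXiX : Xi * X = 1.
Proof.
rewrite /fps_lau lauM mul1r -[fpsX]mulr1 -[fpsX]expr1 fpsXnM.
exact: (lau_shift 0 1).
Qed.

Lemma lthetaX : ltheta X = X.
Proof. by rewrite ltheta_fps fthetaX. Qed.

Lemma pactX q (m : M) : pact q (X *: m) = X *: pact (q \Po ('X + 1)) m.
Proof. exact: (pact_shift q m lthetaX). Qed.

Lemma XiK (m : M) : X *: (Xi *: m) = m.
Proof. by rewrite scalerA mulrC mulXiX scale1r. Qed.

Lemma XK (m : M) : Xi *: (X *: m) = m.
Proof. by rewrite scalerA mulXiX scale1r. Qed.

Section Family.
Variables (n : nat) (e : 'I_n -> M).

Definition lat : set M := [set m | exists a : 'I_n -> fps K, m = \sum_i fps_lau (a i) *: e i].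

Lemma lat_gen i : lat (e i).
Proof.
exists (fun j => (j == i)%:R); rewrite (bigD1 i) //= eqxx rmorph1 scale1r.
by rewrite big1 ?addr0 // => j /negbTE ->; rewrite rmorph0 scale0r.
Qed.

Lemma lat0 : lat 0.
Proof. by exists (fun=> 0); rewrite big1 // => i _; rewrite rmorph0 scale0r. Qed.

Lemma latD u v : lat u -> lat v -> lat (u + v).
Proof.
move=> [a ->] [b ->]; exists (fun i => a i + b i).
by rewrite -big_split; apply: eq_bigr => i _; rewrite rmorphD scalerDl.
Qed.

Lemma latZ f u : lat u -> lat (fps_lau f *: u).
Proof.
move=> [a ->]; exists (fun i => f * a i).
by rewrite scaler_sumr; apply: eq_bigr => i _; rewrite scalerA rmorphM.
Qed.

Lemma lat_sum p (y : 'I_p -> M) : (forall i, lat (y i)) -> lat (\sum_i y i).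
Proof. by move=> Hy; elim/big_ind: _ => //; [apply: lat0 | apply: latD]. Qed.

Lemma lat_min (T : set M) : T 0 -> (forall u v, T u -> T v -> T (u + v)) ->
  (forall f u, T u -> T (fps_lau f *: u)) -> (forall i, T (e i)) -> lat `<=` T.
Proof.
move=> T0 TD TZ Te _ [a ->]; elim/big_ind: _ => //= i _.
by apply/TZ/Te.
Qed.

Lemma latXn N u : lat u -> lat (X ^+ N *: u).
Proof. by rewrite -rmorphXn; apply: latZ. Qed.

Definition stable := forall i, lat (nabla (e i)).
Definition full := forall z, exists N, lat (X ^+ N *: z).
Definition latX : set M := [set m | exists2 m', lat m' & m = X *: m'].
Definition annihilates (G : {poly K}) := forall m, lat m -> latX (pact G m).

Lemma latX0 : latX 0.
Proof. by exists 0; [apply: lat0 | rewrite scaler0]. Qed.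

Lemma latXD u v : latX u -> latX v -> latX (u + v).
Proof.
by move=> [a La ->] [b Lb ->]; exists (a + b); [apply: latD | rewrite scalerDr].
Qed.

Lemma latXZ f u : latX u -> latX (fps_lau f *: u).
Proof.
by move=> [a La ->]; exists (fps_lau f *: a); [apply: latZ | rewrite !scalerA mulrC].
Qed.

Lemma latX_sum p (y : 'I_p -> M) : (forall i, latX (y i)) -> latX (\sum_i y i).
Proof. by move=> Hy; elim/big_ind: _ => //; [apply: latX0 | apply: latXD]. Qed.

Hypothesis st : stable.

Lemma lat_nabla m : lat m -> lat (nabla m).
Proof.
move: m; suff H : lat `<=` [set m | lat m /\ lat (nabla m)] by move=> m /H[].
apply: lat_min => [|u v [Lu Lu'] [Lv Lv']|f u [Lu Lu']|i].
- by rewrite /= nabla0; split; apply: lat0.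
- by rewrite /= nablaD; split; apply: latD.
- by rewrite /= nablaM ltheta_fps; split; [|apply: latD]; apply: latZ.
by split; [apply: lat_gen | apply: st].
Qed.

Lemma lat_pact q m : lat m -> lat (pact q m).
Proof.
move=> Lm; apply: lat_sum => i; apply: latZ.
by elim: (i : nat) => //= j; apply: lat_nabla.
Qed.

(** Writing f = f(0) + x g, the operator q(nabla) commutes with f up to x L, since
    nabla preserves x L.  In particular q(nabla) is linear on L / x L. *)
Lemma pact_fps q f m : lat m ->
  exists2 w, lat w & pact q (fps_lau f *: m) = laurC (f 0%N) *: pact q m + X *: w.
Proof.
move=> Lm; have [g Eg] := fps_decomp f.
exists (pact (q \Po ('X + 1)) (fps_lau g *: m)); first by apply/lat_pact/latZ.
by rewrite {1}Eg rmorphD rmorphM scalerDl -scalerA pactDr pactK pactX.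
Qed.

Lemma annihilates_gen G : (forall i, latX (pact G (e i))) -> annihilates G.
Proof.
move=> HG; suff H : lat `<=` [set m | lat m /\ latX (pact G m)] by move=> m /H[].
apply: lat_min => [|u v [Lu Lu'] [Lv Lv']|f u [Lu Lu']|i].
- by rewrite /= pact0r; split; [apply: lat0 | apply: latX0].
- by rewrite /= pactDr; split; [apply: latD | apply: latXD].
- split; first exact: latZ.
  have [w Lw ->] := pact_fps G f Lu; apply: latXD; first exact: latXZ.
  by exists w.
by split; [apply: lat_gen | apply: HG].
Qed.

End Family.

(** Lattices only occur through their generating families, and only the existence
    of one with a prescribed annihilating polynomial modulo x matters. *)
Definition lattice_with (G : {poly K}) :=
  exists n (e : 'I_n -> M), [/\ stable e, full e & annihilates e G].

(** The new lattice is L' = x L + G0(nabla) L.  On x L, G0(nabla - 1) x = x G0(nabla)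
    lands in x L'; on G0(nabla) L, first G0(nabla) H(nabla) lands in x L, and then
    G0(nabla - 1) sends x L to x G0(nabla) L, inside x L'. *)
Lemma shear (G0 H : {poly K}) : lattice_with (G0 * H) ->
  lattice_with (translate 1 G0 * H).
Proof.
move=> [n [e [st fl an]]].
pose e' (k : 'I_(n + n)) := match fintype.split k with
  inl i => X *: e i | inr i => pact G0 (e i) end.
have e'l i : lat e' (X *: e i).
  by have := lat_gen e' (lshift n i); rewrite /e' (unsplitK (inl i)).
have e'r i : lat e' (pact G0 (e i)).
  by have := lat_gen e' (rshift n i); rewrite /e' (unsplitK (inr i)).
have e'P (T : set M) : (forall i, T (X *: e i)) -> (forall i, T (pact G0 (e i))) ->
    forall k, T (e' k).
  by move=> Tl Tr k; rewrite /e'; case: (fintype.split k).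
have XL m : lat e m -> lat e' (X *: m).
  move: m; apply: lat_min => [|u v|f u|i] //=.
  - by rewrite scaler0; apply: lat0.
  - by rewrite scalerDr; apply: latD.
  by rewrite scalerA mulrC -scalerA; apply: latZ.
have GL m : lat e m -> lat e' (pact G0 m).
  move: m; suff S : lat e `<=` [set m | lat e m /\ lat e' (pact G0 m)] by move=> m /S[].
  apply: lat_min => [|u v [Lu Lu'] [Lv Lv']|f u [Lu Lu']|i].
  - by rewrite /= pact0r; split; apply: lat0.
  - by rewrite /= pactDr; split; apply: latD.
  - split; first exact: latZ.
    have [w Lw ->] := pact_fps st G0 f Lu; apply: latD; first exact: latZ.
    exact: XL.
  by split; [apply: lat_gen | apply: e'r].
have st' : stable e'.
  apply: (e'P (fun m => lat e' (nabla m))) => i.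
    by rewrite nablaM lthetaX -scalerDr; apply/XL/latD/st/lat_gen.
  by rewrite -pact_nabla; apply/GL/st.
exists (n + n)%N, e'; split=> //.
  by move=> z; have [N LN] := fl z; exists N.+1; rewrite exprS -scalerA; apply: XL.
have shiftX (u : M) : pact (translate 1 G0) (X *: u) = X *: pact G0 u.
  have E := translateS 0 G0; rewrite translate0 in E.
  by rewrite pactX E.
apply: (annihilates_gen st'); apply: (e'P (fun m => latX e' (pact (translate 1 G0 * H) m))) => i.
  rewrite mulrC pactM shiftX pactX.
  by eexists; last reflexivity; apply: lat_pact.
rewrite -pactM mulrAC -mulrA pactM.
have [l Ll ->] := an _ (lat_gen e i); rewrite shiftX.
by eexists; last reflexivity; apply: GL.
Qed.

(** The new lattice is x^-1 L, on which nabla + 1 acts as nabla does on L. *)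
Lemma lattice_scale (G : {poly K}) : lattice_with G -> lattice_with (G \Po ('X + 1)).
Proof.
move=> [n [e [st fl an]]].
pose e' i := Xi *: e i.
have XL m : lat e' m <-> lat e (X *: m).
  split=> [[a ->]|[a E]]; exists a.
    by rewrite scaler_sumr; apply: eq_bigr => i _; rewrite scalerA mulrC -scalerA XiK.
  by rewrite -[m]XK E scaler_sumr; apply: eq_bigr => i _; rewrite !scalerA mulrC.
have shiftX q (m : M) : X *: pact (q \Po ('X + 1)) m = pact q (X *: m).
  by rewrite pactX.
have st' : stable e'.
  move=> i; apply/XL; have := lat_nabla st (lat_gen e i).
  rewrite -{1}[e i]XiK nablaM lthetaX XiK => Ln.
  rewrite -[X *: _](addKr (e i)); apply: latD => //.
  by rewrite -scaleN1r -(rmorphN1 (@fps_lau K)); apply/latZ/lat_gen.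
exists n, e'; split=> //.
  by move=> z; have [N LN] := fl z; exists N; apply/XL/(latXn 1).
move=> m /XL Lm; have [l Ll El] := an _ Lm; exists (Xi *: l).
  by apply/XL; rewrite XiK.
by rewrite XiK -[LHS]XK shiftX El XK.
Qed.

Definition translatez (z : int) (q : {poly K}) : {poly K} := q \Po ('X - z%:~R%:P).

(** A root is lowered by raising all the other ones and then rescaling the
    lattice. *)
Lemma shear_int (z : int) (G0 H : {poly K}) : lattice_with (G0 * H) ->
  lattice_with (translatez z G0 * H).
Proof.
have trD i j q : translatez i (translatez j q) = translatez (i + j) q.
  rewrite /translatez -comp_polyA comp_polyB comp_polyX comp_polyC.
  by rewrite rmorphD polyCD opprD addrA.
have tr0 q : translatez 0 q = q by rewrite /translatez subr0 comp_polyXr.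
have step G1 H1 : lattice_with (G1 * H1) -> lattice_with (translatez 1 G1 * H1).
  by move/shear.
have unstep G1 H1 : lattice_with (G1 * H1) -> lattice_with (translatez (- 1) G1 * H1).
  have tr1 q : q \Po ('X + 1) = translatez (-1) q.
    by rewrite /translatez mulrNz polyCN opprK.
  rewrite mulrC => /step/lattice_scale; rewrite comp_polyM !tr1 trD.
  by rewrite subrr tr0 mulrC.
move=> HG; case: z => n; last rewrite NegzE; elim: n => [|n IHn].
- by rewrite tr0.
- by rewrite -add1n PoszD -trD; apply: step.
- exact: unstep.
by rewrite -addn1 PoszD opprD addrC -trD; apply: unstep.
Qed.

Lemma shear_seq (s : seq ({poly K} * int)) (H : {poly K}) :
  lattice_with (\prod_(x <- s) x.1 * H) ->
  lattice_with (\prod_(x <- s) translatez x.2 x.1 * H).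
Proof.
elim: s H => [|x s IHs] H; first by rewrite !big_nil.
rewrite !big_cons -mulrA => /(shear_int x.2); rewrite mulrCA => /IHs.
by rewrite mulrCA mulrA.
Qed.

(** Modulo x L, nabla acts on the generators through the matrix A of the constant
    terms of its coefficients; apply Cayley-Hamilton to A. *)
Lemma lattice_annihilator n (e : 'I_n -> M) : stable e ->
  exists2 G : {poly K}, G \is monic & annihilates e G.
Proof.
case: n e => [|n] e st.
  exists 1; first exact: monic1.
  by move=> _ [a ->]; rewrite big_ord0 pact0r; apply: latX0.
have /choice[a Ha] := st.
pose A := \matrix_(i < n.+1, j < n.+1) a i j 0%N.
have /choice[w Hw] i : exists w, lat e w /\ nabla (e i) = \sum_j laurC (A i j) *: e j + X *: w.
  have /choice[g Hg] := fun j => fps_decomp (a i j).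
  exists (\sum_j fps_lau (g j) *: e j); split; first by exists g.
  rewrite Ha scaler_sumr -big_split; apply: eq_bigr => j _.
  by rewrite {1}Hg mxE rmorphD rmorphM scalerDl scalerA.
have CH q i : latX e (pact q (e i) - \sum_j laurC (horner_mx A q i j) *: e j).
  elim/poly_ind: q i => [|q b IHq] i.
    rewrite pact0 rmorph0 big1 ?subr0; first exact: latX0.
    by move=> j _; rewrite mxE rmorph0 scale0r.
  have [Lw Ew] := Hw i.
  have -> : pact (q * 'X + b%:P) (e i) - \sum_j laurC (horner_mx A (q * 'X + b%:P) i j) *: e j
     = \sum_j laurC (A i j) *: (pact q (e j) - \sum_l laurC (horner_mx A q j l) *: e l)
       + X *: pact (q \Po ('X + 1)) (w i).
    have E1 : pact (q * 'X + b%:P) (e i) = \sum_j laurC (A i j) *: pact q (e j)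
        + X *: pact (q \Po ('X + 1)) (w i) + laurC b *: e i.
      rewrite pactDl pactMX pactC Ew pactDr pactX pact_sum.
      by congr (_ + _ + _); apply: eq_bigr => j _; rewrite pactK.
    have E2 : \sum_j laurC (horner_mx A (q * 'X + b%:P) i j) *: e j =
        \sum_j laurC (A i j) *: (\sum_l laurC (horner_mx A q j l) *: e l) + laurC b *: e i.
      have -> : horner_mx A (q * 'X + b%:P) = A *m horner_mx A q + b%:M.
        by rewrite mulrC rmorphD rmorphM /= horner_mx_X horner_mx_C.
      under eq_bigr do rewrite !mxE rmorphD scalerDl rmorph_sum scaler_suml.
      rewrite big_split /= exchange_big; congr (_ + _).
        apply: eq_bigr => j _; rewrite scaler_sumr; apply: eq_bigr => l _.
        by rewrite rmorphM scalerA.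
      rewrite (bigD1 i) //= eqxx mulr1n big1 ?addr0 // => j /negbTE ji.
      by rewrite eq_sym ji mulr0n rmorph0 scale0r.
    rewrite E1 E2 opprD addrACA subrr addr0 addrAC; congr (_ + _).
    by rewrite -sumrB; apply: eq_bigr => j _; rewrite scalerBr.
  apply: latXD; first by apply: latX_sum => j; apply: latXZ.
  by eexists; last reflexivity; apply: lat_pact.
exists (char_poly A); first exact: char_poly_monic.
apply: (annihilates_gen st) => i; have := CH (char_poly A) i.
rewrite Cayley_Hamilton big1 ?subr0 // => j _.
by rewrite mxE rmorph0 scale0r.
Qed.

(** The image in M of the given model.  The model itself may have x-torsion, which
    dies in M. *)
Lemma lattice_of_model : regular_singular M -> exists n (e : 'I_n -> M), stable e /\ full e.
Proof.
move=> [E [phi [psi [_ psiK]]]]; have [n [e eE]] := conn_fin E.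
pose j m : M := phi (tens (@fps_lau K) 1 m).
pose e' i := j (e i).
have jD u v : j (u + v) = j u + j v by rewrite /j tensDr raddfD.
have jZ f u : j (f *: u) = fps_lau f *: j u.
  by rewrite /j tensZr mulrC -tensZl linearZ.
have j0 : j 0 = 0 by apply: (addIr (j 0)); rewrite -jD !add0r.
have jL m : lat e' (j m).
  have /mspan_rangeP[a ->] : mspan (range e) m by rewrite eE.
  exists a; rewrite (big_morph _ jD j0); apply: eq_bigr => i _; exact: jZ.
exists n, e'; split.
  move=> i; rewrite /e' /j -chom_nabla.
  have -> : nabla (tens (@fps_lau K) 1 (e i) : gamma E) = tens (@fps_lau K) 1 (nabla (e i)).
    rewrite [LHS]gamma_nablaE.
    have -> : ltheta 1 = 0 :> laurent K.
      by rewrite -(rmorph1 (@laurC K)) ltheta_fps fthetaC rmorph0.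
    by rewrite tensE scale0r add0r.
  exact: jL.
move=> z; rewrite -(psiK z); elim/tens_ind: (psi z) => [|u v [N LN] [N' LN']|b m].
- by exists 0%N; rewrite raddf0 scaler0; apply: lat0.
- exists (N + N')%N; rewrite raddfD scalerDr; apply: latD.
    by rewrite addnC exprD -scalerA; apply: latXn.
  by rewrite exprD -scalerA; apply: latXn.
have [N [F ->]] := lau_ex1 b; exists N.
have -> : phi (tens (@fps_lau K) (lau N F) m) = lau N F *: j m.
  by rewrite /j -linearZ tensZl mulr1.
rewrite scalerA (_ : X ^+ N * lau N F = fps_lau F); first exact: latZ.
rewrite -rmorphXn /fps_lau lauM fpsXnM add0n.
exact: (lau_shift 0 N).
Qed.

End Lattice.

Lemma tau_lattice (C : closedFieldType) (R : cnlAlg C) (tau : set C)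
  (tauP : forall c : C, exists! t : C, tau t /\ exists z : int, c - t = z%:~R)
  (M : MC R) : regular_singular M ->
  exists (G : {poly R}) (P : {poly C}), [/\ lattice_with M G,
    coef_in 1 (G - const_poly R P) & forall c, root P c -> tau c].
Proof.
move=> /lattice_of_model[n [e [st fl]]]; have [G mG aG] := lattice_annihilator st.
have [s [Es Hs]] := hensel_split mG.
have /choice[tz Htz] : forall c : C, exists tz : C * int, tau tz.1 /\ c - tz.1 = tz.2%:~R.
  by move=> c; have [t [[tt [z E]] _]] := tauP c; exists (t, z).
pose s' := [seq (x.1, - (tz x.2).2) | x <- s].
have L : lattice_with M (\prod_(x <- s') translatez x.2 x.1 * 1).
  apply: shear_seq; rewrite mulr1 /s' big_map /= -Es.
  by exists n, e.
exists (\prod_(x <- s) translatez (- (tz x.2).2) x.1).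
move: L; rewrite mulr1 /s' big_map /= => L.
suff [P GP tP] : exists2 P : {poly C},
    coef_in 1 (\prod_(x <- s) translatez (- (tz x.2).2) x.1 - const_poly R P) &
    forall c, root P c -> tau c by exists P.
elim: s Hs {Es L s'} => [|[G1 c] s IHs] Hs.
  exists 1; first by rewrite big_nil rmorph1 subrr; apply: coef_in0.
  by move=> c; rewrite (negbTE (root1 _)).
have [|P GP tP] := IHs; first by move=> x sx; apply: Hs; rewrite inE sx orbT.
have [m Gm] := Hs (G1, c) (mem_head _ _).
exists (('X - (tz c).1%:P) ^+ m * P).
  rewrite big_cons rmorphM; apply: coef_in_mulB => //=.
  have -> : const_poly R (('X - (tz c).1%:P) ^+ m) =
      translatez (- (tz c).2) (const_poly R (('X - c%:P) ^+ m)).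
    rewrite /translatez !rmorphXn /=; congr (_ ^+ m).
    rewrite !rmorphB /= /const_poly !map_polyX !map_polyC /= comp_polyX comp_polyC.
    rewrite -addrA; congr (_ + _); apply: oppr_inj; rewrite opprD !opprK -polyCD; congr (_%:P).
    have -> : (tz c).1 = c - (tz c).2%:~R by rewrite -(Htz c).2 subKr.
    by rewrite scalerBl scaler_int mulrNz addrC.
  by rewrite /translatez -comp_polyB; apply: coef_in_comp.
move=> c'; rewrite rootM => /orP[|/tP//].
rewrite /root horner_exp expf_eq0 !hornerE subr_eq0 => /andP[_ /eqP ->].
exact: (Htz c).1.
Qed.

(** * Inverting x *)

Lemma chom_iso (K A : comNzRingType) (c : {rmorphism K -> A}) (d : A -> A)
    (E F : conn c d) (f : chom E F) :
  injective f -> (forall z, exists y, f y = z) -> is_iso f.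
Proof.
move=> finj /choice[g gK].
have gL : linear g by move=> a u v; apply: finj; rewrite linearP !gK.
pose gLin : {linear F -> E} :=
  HB.pack g (GRing.isLinear.Build A F E *:%R g gL).
have gN m : gLin (nabla m) = nabla (gLin m) by apply: finj; rewrite gK chom_nabla gK.
by exists (Chom gN); split=> [m|m]; [apply: finj; apply: gK | apply: gK].
Qed.

Section Localization.
Variables (K : comNzRingType) (N : MClog K) (Z : MC K) (j : N -> Z).
Local Notation X := (fps_lau fpsX : laurent K).
Hypothesis jD : {morph j : u v / u + v}.
Hypothesis jZ : forall f u, j (f *: u) = fps_lau f *: j u.
Hypothesis jnabla : forall u, j (nabla u) = nabla (j u).
Hypothesis jker : forall u, j u = 0 -> exists a, fpsX ^+ a *: u = 0.
Hypothesis jfull : forall z, exists a u, X ^+ a *: z = j u.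

Definition loc_fun : extscal (@fps_lau K) N -> Z :=
  extlift (@fps_lau K) (fun (b : laurent K) (u : N) => b *: j u).

Let locE b u : loc_fun (tens (@fps_lau K) b u) = b *: j u.
Proof.
rewrite /loc_fun extliftE // => [m c c'|c m m'|c a m].
- by rewrite scalerDl.
- by rewrite jD scalerDr.
by rewrite jZ scalerA.
Qed.

Let locD : {morph loc_fun : u v / u + v}.
Proof.
apply: extliftD => [m c c'|c m m'|c a m].
- by rewrite scalerDl.
- by rewrite jD scalerDr.
by rewrite jZ scalerA.
Qed.

Let loc0 : loc_fun 0 = 0.
Proof. by apply: (addIr (loc_fun 0)); rewrite -locD !add0r. Qed.

Let loc_linear : linear loc_fun.
Proof.
move=> a y z; rewrite locD; congr (_ + _).
elim/tens_ind: y => [|y1 y2 IH1 IH2|b y]; first by rewrite scaler0 loc0 scaler0.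
  by rewrite scalerDr !locD IH1 IH2 scalerDr.
by rewrite tensZl !locE scalerA.
Qed.

HB.instance Definition _ := GRing.isLinear.Build (laurent K)
  (extscal (@fps_lau K) N) Z *:%R loc_fun loc_linear.

Let loc_nabla (u : gamma N) : loc_fun (nabla u) = nabla (loc_fun u).
Proof.
elim/tens_ind: u => [|u v IHu IHv|b m].
- by rewrite nabla0 loc0 nabla0.
- by rewrite (@nablaD _ _ _ _ (gamma N)) !locD nablaD IHu IHv.
by rewrite [nabla _]gamma_nablaE locD !locE nablaM jnabla.
Qed.

Definition loc_hom : chom (gamma N) Z :=
  @Chom _ _ _ _ (gamma N) Z loc_fun loc_nabla.

Lemma loc_homE b u : loc_hom (tens (@fps_lau K) b u) = b *: j u.
Proof. exact: locE. Qed.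

(** every tensor is of the form x^-a (x) u *)
Let denominator (t : gamma N) : exists a u, t = tens (@fps_lau K) (lau a 1) u.
Proof.
have up a b u : tens (@fps_lau K) (lau a 1) u =
    tens (@fps_lau K) (lau (a + b) 1) (fpsX ^+ b *: u).
  by rewrite tensZr lauM addn0 mul1r -[fpsX ^+ b]mulr1 fpsXnM lau_shift.
elim/tens_ind: t => [|_ _ [a [u ->]] [b [v ->]]|f u].
- exists 0%N, 0; apply: (addIr (tens (@fps_lau K) (lau 0 1) 0)).
  by rewrite -tensDr !add0r.
- exists (a + b)%N, (fpsX ^+ b *: u + fpsX ^+ a *: v).
  by rewrite tensDr -up [in tens _ _ (fpsX ^+ a *: v)]addnC -up.
have [a [F ->]] := lau_ex1 f; exists a, (F *: u).
by rewrite tensZr lauM addn0 mul1r.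
Qed.

Lemma loc_hom_iso : is_iso loc_hom.
Proof.
have unit a : lau a 1 * X ^+ a = 1.
  rewrite -rmorphXn /fps_lau lauM mul1r -[fpsX ^+ a]mulr1 fpsXnM addn0.
  exact: (lau_shift 0 a).
apply: chom_iso => [t t' E|z]; last first.
  have [a [u Eu]] := jfull z; exists (tens (@fps_lau K) (lau a 1) u).
  by rewrite loc_homE -Eu scalerA unit scale1r.
apply/eqP; rewrite -subr_eq0; apply/eqP.
have : loc_hom (t - t') = 0.
  by apply/eqP; rewrite [loc_hom _]raddfB subr_eq0; apply/eqP.
have [a [u ->]] := denominator (t - t'); rewrite loc_homE => E0.
have /jker[b Eb] : j u = 0.
  by rewrite -[j u]scale1r -(unit a) mulrC -scalerA E0 scaler0.
have -> : lau a 1 = (lau a 1 * lau b 1) * fps_lau (fpsX ^+ b) :> laurent K.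
  by rewrite -mulrA [fps_lau _]rmorphXn unit mulr1.
rewrite -tensZr Eb; apply: (addIr (tens (@fps_lau K) (lau a 1 * lau b 1) 0)).
by rewrite -tensDr !add0r.
Qed.

End Localization.

(** * The logarithmic object of a lattice *)

HB.instance Definition _ (A : comNzRingType) (M : lmodType A) (S : set M) :=
  GRing.isScaleClosed.Build A M (mspanp S)
    (fun a v Sv => introT (mspanpP S _) (mspanZ a (elimT (mspanpP S _) Sv))).

Definition span_mod (A : comNzRingType) (M : lmodType A) (S : set M) : Type :=
  {m : M | m \in mspanp S}.

Section SpanMod.
Variables (A : comNzRingType) (M : lmodType A) (S : set M).
HB.instance Definition _ := [isSub of span_mod S for @sval _ _].
HB.instance Definition _ := [Choice of span_mod S by <:].
HB.instance Definition _ := [SubChoice_isSubLmodule of span_mod S by <:].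

Lemma span_val0 : val (0 : span_mod S) = 0.
Proof. exact: raddf0. Qed.
Lemma span_valD (u v : span_mod S) : val (u + v) = val u + val v.
Proof. exact: raddfD. Qed.
Lemma span_valZ a (u : span_mod S) : val (a *: u) = a *: val u.
Proof. exact: linearZ. Qed.
End SpanMod.

Section SubLattice.
Variables (K : comNzRingType) (M : MC K) (n : nat) (e : 'I_n -> M).
Hypothesis st : stable e.
Local Notation X := (fps_lau fpsX : laurent K).
Local Notation Mr := (restr (@fps_lau K) M).

Let S : set Mr := range (e : 'I_n -> Mr).
Local Notation sub := (span_mod S).

Let latP (m : M) : reflect (lat e m) ((m : Mr) \in mspanp S).
Proof.
by apply: (iffP (mspanpP S _)) => [/mspan_rangeP|H]; last apply/mspan_rangeP.
Qed.

Lemma sub_fin_gen : fin_gen sub.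
Proof.
have eS i : (e i : Mr) \in mspanp S by apply/latP/lat_gen.
exists n, (fun i => Sub (e i) (eS i) : sub); apply/seteqP; split=> // v _.
have /latP[a Ea] := valP v; apply/mspan_rangeP; exists a; apply: val_inj.
rewrite [LHS]Ea (big_morph _ (@span_valD _ _ S) (span_val0 S)); apply: eq_bigr => i _.
by rewrite span_valZ SubK.
Qed.

Definition sub_nabla (m : sub) : sub :=
  Sub (nabla (val m : M) : Mr) (introT (latP _) (lat_nabla st (elimT (latP _) (valP m)))).

(** the projection typed in M, where nabla and the Laurent scaling live *)
Let sv (m : sub) : M := val m.
Let svD u v : sv (u + v) = sv u + sv v. Proof. exact (@span_valD _ _ S u v). Qed.
Let svZ f u : sv (f *: u) = fps_lau f *: sv u. Proof. exact (@span_valZ _ _ S f u). Qed.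
Let sv_nabla u : sv (sub_nabla u) = nabla (sv u). Proof. exact: SubK. Qed.
Let sv_inj : injective sv. Proof. exact: val_inj. Qed.

Lemma sub_nablaD : {morph sub_nabla : u v / u + v}.
Proof. by move=> u v; apply: sv_inj; rewrite svD !sv_nabla svD nablaD. Qed.

Lemma sub_nablaM f m : sub_nabla (f *: m) = ftheta f *: m + f *: sub_nabla m.
Proof. by apply: sv_inj; rewrite svD !svZ !sv_nabla svZ nablaM ltheta_fps. Qed.

Lemma sub_nablaK (a : K) m : sub_nabla (fpsC a *: m) = fpsC a *: sub_nabla m.
Proof. by rewrite sub_nablaM fthetaC scale0r add0r. Qed.

Definition sub_lattice : MClog K := Conn sub_fin_gen sub_nablaD sub_nablaK sub_nablaM.

Definition sub_val (m : sub_lattice) : M := val (m : sub).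

Lemma sub_valD : {morph sub_val : u v / u + v}.
Proof. exact: svD. Qed.

Lemma sub_valZ f u : sub_val (f *: u) = fps_lau f *: sub_val u.
Proof. exact: svZ. Qed.

Lemma sub_val_nabla u : sub_val (nabla u) = nabla (sub_val u).
Proof. exact: sv_nabla. Qed.

Lemma sub_val_inj : injective sub_val.
Proof. exact: val_inj. Qed.

Lemma sub_val0 : sub_val 0 = 0.
Proof. exact (@span_val0 _ _ S). Qed.

Lemma lat_sub_val m : lat e m -> exists u, m = sub_val u.
Proof. by move=> /latP Lm; exists (Sub (m : Mr) Lm : sub); rewrite /sub_val SubK. Qed.

Lemma sub_val_lat u : lat e (sub_val u).
Proof. exact/latP/valP. Qed.

Lemma sub_lattice_poly G : annihilates e G ->
  forall u : sub_lattice, exists u', pact G u = fpsX *: u'.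
Proof.
move=> an u; have [m /lat_sub_val[u' ->] E] := an _ (sub_val_lat u).
exists u'; apply: sub_val_inj; rewrite sub_valZ -E.
exact: (pact_morph (g := sub_val)).
Qed.

Lemma sub_lattice_Xinj (u : sub_lattice) : fpsX *: u = 0 -> u = 0.
Proof.
move=> /(congr1 sub_val); rewrite sub_valZ sub_val0 => E.
by apply: sub_val_inj; rewrite -[sub_val u]XK E scaler0.
Qed.

Hypothesis fl : full e.

Lemma sub_val_full (z : M) : exists a u, X ^+ a *: z = sub_val u.
Proof. by have [a /lat_sub_val[u Eu]] := fl z; exists a, u. Qed.

End SubLattice.

(** * Compatibility of reduction with inverting x *)

Section ReducedModel.
Variables (C : fieldType) (R : cnlAlg C) (E : MClog R) (M : MC R) (j : E -> M).
Local Notation X := (fps_lau fpsX : laurent R).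
Hypothesis jD : {morph j : u v / u + v}.
Hypothesis jZ : forall f u, j (f *: u) = fps_lau f *: j u.
Hypothesis jnabla : forall u, j (nabla u) = nabla (j u).
Hypothesis jinj : injective j.
Hypothesis jfull : forall z, exists a u, X ^+ a *: z = j u.
Variable k : nat.
Local Notation N := (red_log E k).
Local Notation Z := (red_lau M k).
Local Notation r := (ideal_exp (cnl_max R)).

Let j0 : j 0 = 0. Proof. by apply: (addIr (j 0)); rewrite -jD !add0r. Qed.

Let j_sum n (y : 'I_n -> E) : j (\sum_i y i) = \sum_i j (y i).
Proof. exact: (big_morph _ jD j0). Qed.

(** j maps r^(k+1) E into r^(k+1) M, so the choice of representatives does not
   matter: see jbar_pi *)
Let jbar (n : N) : Z := red_lau_pi k (j (qrepr (n : qmod (@red_rel _ _ _ _ _ E k)))).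

Let jbar_pi m : jbar (red_log_pi k m) = red_lau_pi k (j m).
Proof.
have /qpi_eq H := qpiK (qpi (@red_rel _ _ _ _ _ E k) m).
rewrite /jbar; apply/qpi_eq; move: H; set m' := qrepr _ => H.
have -> : j m' - j m = j (m' - m).
  by apply: (addIr (j m)); rewrite -jD !subrK.
move: (m' - m) H; apply: mspan_min.
- by rewrite /= j0; apply: mspan0.
- by move=> u v Hu Hv; rewrite /= jD; apply: mspanD.
- by move=> f u Hu; rewrite /= jZ; apply: mspanZ.
move=> _ [b [u [rb ->]]] /=; rewrite jZ; apply: sub_mspan.
by exists b, (j u).
Qed.

Let logP (n : N) : exists m, n = red_log_pi k m. Proof. exact: red_piP. Qed.
Let lauP (z : Z) : exists m, z = red_lau_pi k m. Proof. exact: red_piP. Qed.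

Let jbarD : {morph jbar : u v / u + v}.
Proof.
move=> u v; have [m ->] := logP u; have [n ->] := logP v.
rewrite [in LHS](_ : _ + _ = red_log_pi k (m + n)); last by rewrite [RHS]red_piD.
by rewrite !jbar_pi jD [LHS]red_piD.
Qed.

Let log_scale f m : f *: (red_log_pi k m : N) = red_log_pi k (fps_incl R f *: m).
Proof. exact: red_piZ. Qed.
Let lau_scale f m : f *: (red_lau_pi k m : Z) = red_lau_pi k (laurent_incl R f *: m).
Proof. exact: red_piZ. Qed.

Let laurent_incl_fps f : laurent_incl R (fps_lau f) = fps_lau (fps_incl R f).
Proof. exact: (map_lauE _ 0). Qed.

Let jbarZ f u : jbar (f *: u) = fps_lau f *: jbar u.
Proof.
have [m ->] := logP u.
by rewrite log_scale !jbar_pi jZ lau_scale laurent_incl_fps.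
Qed.

Let jbar_nabla u : jbar (nabla u) = nabla (jbar u).
Proof.
have [m ->] := logP u.
rewrite [nabla _](_ : _ = red_log_pi k (nabla m)); last exact: red_nablaE.
by rewrite !jbar_pi jnabla [RHS]red_nablaE.
Qed.

Let jbar_act l u : jbar (ca_act N l u) = ca_act Z l (jbar u).
Proof.
have [m ->] := logP u; rewrite -(tpiK l) jbar_pi.
rewrite [ca_act N _ _](_ : _ = red_log_pi k (fpsC (repr l) *: m)); last exact: red_actE.
by rewrite jbar_pi jZ [RHS]red_actE.
Qed.

(** If j m lies in r^(k+1) M, clearing the denominators of the vectors that occur
   in a decomposition puts x^a m in r^(k+1) E. *)
Let jbar_ker u : jbar u = 0 -> exists a, fpsX ^+ a *: u = 0.
Proof.
have [m -> {u}] := logP u; rewrite jbar_pi => E0.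
have : mspan (@red_rel _ _ _ _ _ M k) (j m).
  by rewrite -[j m]subr0; apply/qpi_eq; rewrite [LHS]E0 qpi0.
move=> [n [f [y [/choice[b Hb] Em]]]].
have /choice[y' Hy] := Hb.
have /choice[a /choice[v Hv]] := fun i => jfull (f i *: y' i).
exists (\sum_i a i)%N.
have [v' Hv'] : exists v' : 'I_n -> E, forall i, X ^+ (\sum_i a i) *: (f i *: y' i) = j (v' i).
  suff /choice[v' Hv'] : forall i, exists w, X ^+ (\sum_i a i) *: (f i *: y' i) = j w by exists v'.
  move=> i; exists (fpsX ^+ (\sum_(l | l != i) a l) *: v i).
  by rewrite (bigD1 i) //= addnC exprD -scalerA Hv jZ rmorphXn.
have -> : fpsX ^+ (\sum_i a i) *: (red_log_pi k m : N) =
    red_log_pi k (\sum_i fpsC (b i) *: v' i).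
  rewrite log_scale rmorphXn /= fps_inclX; congr (red_log_pi k _); apply: jinj.
  rewrite jZ Em j_sum rmorphXn scaler_sumr; apply: eq_bigr => i _.
  have [_ ->] := Hy i.
  by rewrite jZ -Hv' !scalerA; congr (_ *: _); rewrite mulrA [LHS]mulrC mulrA.
rewrite -[RHS](qpi0 (@red_rel _ _ _ _ _ E k)); apply/qpi_eq; rewrite subr0.
apply: mspan_sum => i; apply: sub_mspan; have [rb _] := Hy i.
by exists (b i), (v' i).
Qed.

Let jbar_full z : exists a u, fps_lau fpsX ^+ a *: z = jbar u.
Proof.
have [m ->] := lauP z; have [a [u Eu]] := jfull m; exists a, (red_log_pi k u).
by rewrite jbar_pi -Eu lau_scale rmorphXn /= laurent_incl_fps fps_inclX.
Qed.

Lemma reduced_model : exists psi : chom (gammaAct N) Z,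
  reduced_iso (loc_hom jD jZ jnabla) psi /\
  forall (l : trunc R k) v, psi (ca_act (gammaAct N) l v) = ca_act Z l (psi v).
Proof.
pose psi : chom (gammaAct N) Z := loc_hom jbarD jbarZ jbar_nabla.
have psiE b u : psi (tens (@fps_lau C) b u) = b *: jbar u by apply: loc_homE.
exists psi; split; first split.
- exact: loc_hom_iso jbar_ker jbar_full.
- by move=> m; rewrite psiE loc_homE !scale1r jbar_pi.
move=> l; apply: tens_ind => [|u v IHu IHv|b u].
- by rewrite !raddf0.
- transitivity (psi (ca_act (gammaAct N) l u) + psi (ca_act (gammaAct N) l v)).
    by rewrite !raddfD.
  by rewrite IHu IHv !raddfD.
rewrite [ca_act _ _ _](_ : _ = tens (@fps_lau C) b (ca_act N l u)); last exact: gamma_funE.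
by rewrite !psiE jbar_act linearZ.
Qed.

End ReducedModel.

(** A common root c of P and P(X - i - 1) would give two elements c and c - i - 1 of
    tau in the same class modulo the integers. *)
Lemma translates_coprime (C : closedFieldType) (charC : [pchar C] =i pred0) (tau : set C)
    (tauP : forall c : C, exists! t : C, tau t /\ exists z : int, c - t = z%:~R)
    (P : {poly C}) : (forall c, root P c -> tau c) ->
  forall i, coprimep P (translate i.+1 P).
Proof.
move=> Ptau i; apply/Pdiv.ClosedField.coprimepP => c Pc; apply/negP.
rewrite /translate horner_comp !hornerE => Pci.
have [t [_ uniq]] := tauP c.
have Et : t = c by apply: uniq; split; [exact: Ptau | exists 0; rewrite subrr].
have : t = c - i.+1%:R.
  by apply: uniq; split; [exact: Ptau | exists i.+1; rewrite subKr].
move/eqP; rewrite Et -subr_eq0 subKr.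
by have /pcharf0P-> := charC.
Qed.

Theorem theorem9p1 (C : closedFieldType) (charC : [pchar C] =i pred0)
  (R : cnlAlg C) (tau : set C)
  (tauP : forall c : C, exists! t : C, tau t /\ exists z : int, c - t = z%:~R)
  (M : MC R) (M_rs : regular_singular M) :
  exists (E : MClog R) (phi : chom (gamma E) M), log_model phi /\
    forall k : nat,
      [/\ forall c : C, is_exponent (red_log E k) c -> tau c,
          free_relative (red_log E k) &
          exists psi : chom (gammaAct (red_log E k)) (red_lau M k),
            reduced_iso phi psi /\
            forall (l : trunc R k) v,
              psi (ca_act (gammaAct (red_log E k)) l v) =
              ca_act (red_lau M k) l (psi v)].
Proof.
have [G [P [[n [e [st fl an]]] GP Ptau]]] := tau_lattice tauP M_rs.
have GX := @sub_lattice_poly _ _ _ _ st _ an.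
exists (sub_lattice st),
  (loc_hom (@sub_valD _ _ _ _ st) (@sub_valZ _ _ _ _ st) (@sub_val_nabla _ _ _ _ st)); split.
  apply: loc_hom_iso (sub_val_full st fl) => u u0; exists 0%N.
  by rewrite scale1r; apply: (@sub_val_inj _ _ _ _ st); rewrite sub_val0.
move=> k; have Pcop := translates_coprime charC tauP Ptau; split.
- by move=> c /(red_log_exponent GX GP)/Ptau.
- exact: red_log_free (@sub_lattice_Xinj _ _ _ _ st) GX GP Pcop _.
exact: reduced_model (@sub_val_inj _ _ _ _ st) (sub_val_full st fl) k.
Qed.
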